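(* Let $\mathrm{id}=\mathrm{id}_d$ denote the identity channel on $\mathbb{C}^{d\times d}$. (Upper bound.) There exist a universal constant $C>0$ and, for all integers $d,N\ge 1$, an incoherent ancilla-free algorithm $\mathcal{A}_{d,N}$ using $N$ measurements such that for every $d\ge 1$ and $\varepsilon>0$: (i) with $N=\lceil C d/\varepsilon^2\rceil$, the algorithm $\mathcal{A}_{d,N}$ is $1/3$-correct for testing $H_0:\mathcal{N}=\mathrm{id}$ versus $H_1: d_{\mathrm{Tr}}(\mathcal{N},\mathrm{id})\ge\varepsilon$ (trace distance); (ii) with $N=\lceil C d/\varepsilon^4\rceil$, the algorithm $\mathcal{A}_{d,N}$ is $1/3$-correct for testing $H_0:\mathcal{N}=\mathrm{id}$ versus $H_1: d_{\diamond}(\mathcal{N},\mathrm{id})\ge\varepsilon$ (diamond distance). (Lower bound.) There exist universal constants $c,\varepsilon_0>0$ and $d_0\ge 1$ such that for all $d\ge d_0$ and $0<\varepsilon\le\varepsilon_0$, any incoherent adaptive ancilla-assisted strategy which distinguishes, with probability at least $2/3$ under each hypothesis, between $\mathcal{N}=\mathrm{id}$ and $d_{\diamond}(\mathcal{N},\mathrm{id})>\varepsilon$ must use, in the worst case, $N\ge c\,d/\varepsilon^2$ measurements; the same holds with $d_{\diamond}(\mathcal{N},\mathrm{id})>\varepsilon$ replaced by $d_{\mathrm{Tr}}(\mathcal{N},\mathrm{id})>\varepsilon$.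
   Context: A $(d_{\mathrm{in}},d_{\mathrm{out}})$-dimensional quantum channel is a map $\mathcal{N}:\mathbb{C}^{d_{\mathrm{in}}\times d_{\mathrm{in}}}\to\mathbb{C}^{d_{\mathrm{out}}\times d_{\mathrm{out}}}$ of the form $\mathcal{N}(\rho)=\sum_k A_k\rho A_k^\dagger$ with $\sum_k A_k^\dagger A_k=\mathbb{I}$. Here $d_{\mathrm{in}}=d_{\mathrm{out}}=d$. A quantum state is a positive semidefinite matrix of trace 1. $\|\cdot\|_1$ is the Schatten 1-norm. Trace distance: $d_{\mathrm{Tr}}(\mathcal{N},\mathcal{M})=\max_{\rho}\|(\mathcal{N}-\mathcal{M})(\rho)\|_1$ over quantum states $\rho$ on $\mathbb{C}^{d_{\mathrm{in}}}$. Diamond distance: $d_\diamond(\mathcal{N},\mathcal{M})=\max_\rho\|(\mathrm{id}_{d_{\mathrm{in}}}\otimes(\mathcal{N}-\mathcal{M}))(\rho)\|_1$ over quantum states $\rho$ on $\mathbb{C}^{d_{\mathrm{in}}}\otimes\mathbb{C}^{d_{\mathrm{in}}}$. A POVM is a finite family $\{M_x\}_{x\in\mathcal{X}}$ of positive semidefinite matrices with $\sum_x M_x=\mathbb{I}$; measuring a state $\rho$ with it gives outcome $x$ with probability $\mathrm{Tr}(\rho M_x)$. Incoherent strategies with $N$ measurements, given black-box access to an unknown channel $\mathcal{N}$: at each step $t=1,\dots,N$ the algorithm chooses an input state $\rho_t$ on $\mathbb{C}^{d_{\mathrm{anc}}}\otimes\mathbb{C}^{d_{\mathrm{in}}}$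 (for some arbitrary finite $d_{\mathrm{anc}}$) and a POVM $\{M^t_x\}_x$ on $\mathbb{C}^{d_{\mathrm{anc}}}\otimes\mathbb{C}^{d_{\mathrm{out}}}$, and observes outcome $x_t$ with probability $\mathrm{Tr}\big((\mathrm{id}_{d_{\mathrm{anc}}}\otimes\mathcal{N})(\rho_t)M^t_{x_t}\big)$. The strategy is ancilla-free if $d_{\mathrm{anc}}=1$, and ancilla-assisted in general. It is adaptive if $\rho_t$ and the POVM at step $t$ may depend on $x_1,\dots,x_{t-1}$, and non-adaptive otherwise. Algorithms may use internal classical randomness (e.g. to choose random input states). After $N$ steps the observations are processed classically and the algorithm outputs $H_0$ or $H_1$. The algorithm is $1/3$-correct if it outputs $H_1$ with probability at most $1/3$ whenever $H_0$ is true and outputs $H_0$ with probability at most $1/3$ whenever $H_1$ is true (no requirement if neither holds). *)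

(* Defs.v *)
From HB Require Import structures.
From mathcomp Require Import all_boot all_order all_algebra.
From mathcomp Require Import spectral complex.
From mathcomp Require mxtens.
From mathcomp Require Import all_classical all_reals all_analysis.
Set Implicit Arguments.
Unset Strict Implicit.
Unset Printing Implicit Defensive.
Import Order.TTheory GRing.Theory Num.Theory.
Local Open Scope classical_set_scope.
Local Open Scope ring_scope.
Local Open Scope complex_scope.
Local Open Scope sesquilinear_scope.

Section Channels.
Context {R : realType}.
Local Notation C := R[i].

(* In R[i], [0 <= z] means that z is real and nonnegative. *)
Definition is_psd n (A : 'M[C]_n) : Prop :=
  A \is hermsymmx /\ forall v : 'cV[C]_n, 0 <= (v ^t* *m A *m v) 0 0.

Definition is_state n (rho : 'M[C]_n) : Prop := is_psd rho /\ \tr rho = 1.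

Definition is_povm n (X : finType) (M : X -> 'M[C]_n) : Prop :=
  (forall x, is_psd (M x)) /\ \sum_x M x = 1%:M.

Definition is_channel m n (Phi : 'M[C]_m -> 'M[C]_n) : Prop :=
  exists (r : nat) (A : 'I_r -> 'M[C]_(n, m)),
    \sum_k (A k) ^t* *m A k = 1%:M /\
    forall rho, Phi rho = \sum_k A k *m rho *m (A k) ^t*.

(* The sum of the singular values of A, which are the square roots of the
   eigenvalues, with multiplicity, of the hermitian matrix A^t* *m A. *)
Definition schatten1 n (A : 'M[C]_n) : R :=
  \sum_i Num.sqrt (complex.Re (spectral_diag (A ^t* *m A) 0 i)).

(* id_a (x) Phi for a linear map Phi: C^a (x) C^m is indexed by 'I_(a * m) as
   in the Kronecker product of mxtens, and Phi is applied to each of the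
   a * a blocks of size m x m. *)
Definition id_tens a m n (Phi : 'M[C]_m -> 'M[C]_n) (rho : 'M[C]_(a * m)) :
    'M[C]_(a * n) :=
  \matrix_(i, j)
    let: (i1, i2) := mxtens.mxtens_unindex i in
    let: (j1, j2) := mxtens.mxtens_unindex j in
    Phi (\matrix_(k, l) rho (mxtens.mxtens_index (i1, k))
                            (mxtens.mxtens_index (j1, l))) i2 j2.

(* For channels the two suprema below are maxima, the set of states being
   compact. *)
Definition trace_dist m n (Phi Psi : 'M[C]_m -> 'M[C]_n) : R :=
  sup [set schatten1 (Phi rho - Psi rho) | rho in @is_state m].

Definition diamond_dist m n (Phi Psi : 'M[C]_m -> 'M[C]_n) : R :=
  sup [set schatten1 (id_tens (fun X => Phi X - Psi X) rho)
      | rho in @is_state (m * m)].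

Variant hypothesis := H0 | H1.

(* A strategy with N measurements and no internal randomness: a decision tree,
   so that the ancilla dimension, input state and POVM of a step, and the final
   answer, may depend on all previous outcomes. *)
Inductive strategy (din dout : nat) : nat -> Type :=
| Answer of hypothesis : strategy din dout 0
| Measurement N (danc : nat) (rho : 'M[C]_(danc * din)) (X : finType)
    (M : X -> 'M[C]_(danc * dout)) of is_state rho & is_povm M &
    (X -> strategy din dout N) : strategy din dout N.+1.

Fixpoint ancilla_free din dout N (s : strategy din dout N) : Prop :=
  match s with
  | Answer _ => True
  | @Measurement _ _ _ danc _ _ _ _ _ next =>
      danc = 1%N /\ forall x, ancilla_free (next x)
  end.

(* The probability that the strategy s, run on the channel Phi, answers h. *)
Fixpoint answer_prob din dout N (s : strategy din dout N)
    (Phi : 'M[C]_din -> 'M[C]_dout) (h : hypothesis) : R :=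
  match s with
  | Answer h' => match h', h with H0, H0 | H1, H1 => 1 | _, _ => 0 end
  | @Measurement _ _ _ _ rho _ M _ _ next =>
      \sum_x complex.Re (\tr (id_tens Phi rho *m M x)) *
             answer_prob (next x) Phi h
  end.

End Channels.

Arguments strategy R din dout N : clear implicits.

(* A strategy with internal randomness: all the random choices are functions of
   a seed drawn beforehand from an arbitrary probability space. *)
Record algorithm (R : realType) (din dout N : nat) := Algorithm {
  seed_disp : measure_display;
  seed : measurableType seed_disp;
  seed_law : probability seed R;
  run : seed -> strategy R din dout N;
  run_measurable : forall (Phi : 'M[R[i]]_din -> 'M[R[i]]_dout) h,
    is_channel Phi ->
    measurable_fun setT (fun w => answer_prob (run w) Phi h)
}.

Arguments run {R din dout N} a w.

Definition ancilla_free_algorithm (R : realType) din dout N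
  (A : algorithm R din dout N) : Prop := forall w, ancilla_free (run A w).

Definition output_prob (R : realType) din dout N (A : algorithm R din dout N)
    (Phi : 'M[R[i]]_din -> 'M[R[i]]_dout) (h : hypothesis) : \bar R :=
  (\int[seed_law A]_w (answer_prob (run A w) Phi h)%:E)%E.

Definition one_third_correct (R : realType) din dout N
    (A : algorithm R din dout N)
    (null alt : ('M[R[i]]_din -> 'M[R[i]]_dout) -> Prop) : Prop :=
  forall Phi, is_channel Phi ->
    (null Phi -> (output_prob A Phi H1 <= (1 / 3)%:E)%E) /\
    (alt Phi -> (output_prob A Phi H0 <= (1 / 3)%:E)%E).

Definition distinguishes (R : realType) din dout N
    (A : algorithm R din dout N)
    (null alt : ('M[R[i]]_din -> 'M[R[i]]_dout) -> Prop) : Prop :=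
  forall Phi, is_channel Phi ->
    (null Phi -> ((2 / 3)%:E <= output_prob A Phi H0)%E) /\
    (alt Phi -> ((2 / 3)%:E <= output_prob A Phi H1)%E).

(* Main.v *)
(* Upper bound.  Write A_k for the Kraus operators, a_k = tr A_k / d, and
   delta = sum_k |A_k - a_k|_2^2 (Frobenius norm).  Expanding A_k = a_k + B_k in
   N(rho) - rho bounds both the trace and the diamond distance to the identity by
   O(sqrt delta), so that delta >= eps^2/8.  A random pure probe that is either a
   basis vector e_i or (e_i +- e_j)/sqrt 2 is sent to itself with mean
   probability at most 1 - delta/(4d): basis vectors detect the off-diagonal part
   of the A_k, and the pairs detect the differences of diagonal entries.
   Repeating O(d/eps^2) times suffices, which also covers d/eps^4 as eps <= 2.

   Lower bound.  For U_i = diag(1,..,u,..,1), with the phase u at position i and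
   |1 - u| = 5 eps, the channels (rho + U_i rho U_i^-1)/2 are at distance more than eps
   from the identity.  For one measurement the relative entropy of the outcome
   laws is at most the squared Hellinger distance of the laws for id and U_i,
   hence at most |(1 - U_i) sqrt(rho)|_2^2; summed over i this is |1 - u|^2.  By
   the chain rule the sum over i of the relative entropies of N outcomes is at
   most 25 N eps^2, whereas distinguishing every i forces it to be of order d. *)
Require Import Defs.
From HB Require Import structures.
From mathcomp Require Import all_boot all_order all_algebra.
From mathcomp Require Import spectral complex.
From mathcomp Require mxtens.
From mathcomp Require Import all_classical all_reals all_analysis.
From mathcomp Require Import measurable_realfun ring lra.
Set Implicit Arguments.
Unset Strict Implicit.
Unset Printing Implicit Defensive.
Import Order.TTheory GRing.Theory Num.Theory.
Local Open Scope ring_scope.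
Local Open Scope complex_scope.
Local Open Scope sesquilinear_scope.

(** * Frobenius norm and trace norm *)

Section Frobenius.
Context {R : realType}.
Local Notation C := R[i].

Definition cabs2 (z : C) : R := complex.Re z ^+ 2 + complex.Im z ^+ 2.

(** The real part makes this a symmetric real bilinear form, so that [fro2] of a real combination
    expands as an ordinary quadratic. *)
Definition dot m n (A B : 'M[C]_(m, n)) : R := complex.Re (\tr (A ^t* *m B)).

Definition fro2 m n (A : 'M[C]_(m, n)) : R := dot A A.

Lemma cabs2_ge0 z : 0 <= cabs2 z.
Proof. by rewrite addr_ge0 ?sqr_ge0. Qed.

Lemma cabs2M x y : cabs2 (x * y) = cabs2 x * cabs2 y.
Proof. by case: x y => [a b] [c d]; rewrite /cabs2 /=; ring. Qed.

Lemma cabs2_conj (z : C) : cabs2 (Num.conj z) = cabs2 z.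
Proof. by case: z => a b; rewrite /cabs2 /= sqrrN. Qed.

Lemma mulJ_cabs2 (z : C) : Num.conj z * z = (cabs2 z)%:C.
Proof.
by case: z => a b; rewrite /cabs2; apply/eqP; rewrite eq_complex /=;
  apply/andP; split; apply/eqP; ring.
Qed.

Lemma cabs2_real (x : R) : cabs2 x%:C = x ^+ 2.
Proof. by rewrite /cabs2 /= expr0n addr0. Qed.

Lemma Re_realM (x : R) (z : C) : complex.Re (x%:C * z) = x * complex.Re z.
Proof. by case: z => a b /=; rewrite mul0r subr0. Qed.

Lemma Re_sum (I : Type) (r : seq I) (P : pred I) (F : I -> C) :
  complex.Re (\sum_(i <- r | P i) F i) = \sum_(i <- r | P i) complex.Re (F i).
Proof. exact: (raddf_sum (@complex.Re R : Rcomplex R -> R)). Qed.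

Lemma ReD (x y : C) : complex.Re (x + y) = complex.Re x + complex.Re y.
Proof. by case: x y => [a b] [c d]. Qed.

Lemma ReN (x : C) : complex.Re (- x) = - complex.Re x.
Proof. by case: x => [a b]. Qed.

Lemma adj_mul m n p (A : 'M[C]_(m, n)) (B : 'M[C]_(n, p)) :
  (A *m B) ^t* = B ^t* *m A ^t*.
Proof. by rewrite trmx_mul map_mxM. Qed.

Lemma adjD m n (A B : 'M[C]_(m, n)) : (A + B) ^t* = A ^t* + B ^t*.
Proof. by rewrite linearD map_mxD. Qed.

Lemma adjN m n (A : 'M[C]_(m, n)) : (- A) ^t* = - A ^t*.
Proof. by rewrite linearN map_mxN. Qed.

Lemma adjZ m n (a : C) (A : 'M[C]_(m, n)) : (a *: A) ^t* = Num.conj a *: A ^t*.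
Proof. by rewrite linearZ map_mxZ. Qed.

Lemma adj1 n : (1%:M : 'M[C]_n) ^t* = 1%:M.
Proof. by rewrite trmx1 map_mx1. Qed.

Lemma adjE m n (A : 'M[C]_(m, n)) i j : (A ^t*) i j = Num.conj (A j i).
Proof. by rewrite !mxE. Qed.

Lemma dotE m n (A B : 'M[C]_(m, n)) :
  dot A B = \sum_i \sum_j (complex.Re (A i j) * complex.Re (B i j) +
                           complex.Im (A i j) * complex.Im (B i j)).
Proof.
rewrite /dot /mxtrace Re_sum exchange_big; apply: eq_bigr => j _ /=.
rewrite mxE Re_sum; apply: eq_bigr => i _; rewrite adjE.
by case: (A i j) (B i j) => [a b] [c d] /=; rewrite mulNr opprK.
Qed.

Lemma fro2E m n (A : 'M[C]_(m, n)) : fro2 A = \sum_i \sum_j cabs2 (A i j).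
Proof. by rewrite /fro2 dotE. Qed.

Lemma fro2_ge0 m n (A : 'M[C]_(m, n)) : 0 <= fro2 A.
Proof. by rewrite fro2E; do 2!apply: sumr_ge0 => ? _; exact: cabs2_ge0. Qed.

Lemma cabs2_le_fro2 m n (A : 'M[C]_(m, n)) i j : cabs2 (A i j) <= fro2 A.
Proof.
rewrite fro2E (bigD1 i) //= (bigD1 j) //= -addrA lerDl addr_ge0 //.
  by apply: sumr_ge0 => ? _; exact: cabs2_ge0.
by do 2!apply: sumr_ge0 => ? _; exact: cabs2_ge0.
Qed.

Lemma dotC m n (A B : 'M[C]_(m, n)) : dot A B = dot B A.
Proof.
rewrite !dotE; do 2!apply: eq_bigr => ? _.
by congr (_ + _); rewrite mulrC.
Qed.

Lemma dotDr m n (A B D : 'M[C]_(m, n)) : dot A (B + D) = dot A B + dot A D.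
Proof. by rewrite /dot mulmxDr raddfD ReD. Qed.

Lemma dotDl m n (A B D : 'M[C]_(m, n)) : dot (A + B) D = dot A D + dot B D.
Proof. by rewrite dotC dotDr !(dotC D). Qed.

Lemma dotNr m n (A B : 'M[C]_(m, n)) : dot A (- B) = - dot A B.
Proof. by rewrite /dot mulmxN raddfN ReN. Qed.

Lemma dotZr m n (x : R) (A B : 'M[C]_(m, n)) : dot A (x%:C *: B) = x * dot A B.
Proof. by rewrite /dot -scalemxAr mxtraceZ Re_realM. Qed.

Lemma dotZl m n (x : R) (A B : 'M[C]_(m, n)) : dot (x%:C *: A) B = x * dot A B.
Proof. by rewrite dotC dotZr dotC. Qed.

Lemma fro2Z m n (a : C) (A : 'M[C]_(m, n)) : fro2 (a *: A) = cabs2 a * fro2 A.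
Proof.
rewrite !fro2E mulr_sumr; apply: eq_bigr => i _; rewrite mulr_sumr.
by apply: eq_bigr => j _; rewrite mxE cabs2M.
Qed.

Lemma fro2N m n (A : 'M[C]_(m, n)) : fro2 (- A) = fro2 A.
Proof. by rewrite /fro2 dotNr dotC dotNr opprK. Qed.

Lemma fro2_adj m n (A : 'M[C]_(m, n)) : fro2 (A ^t*) = fro2 A.
Proof.
rewrite !fro2E exchange_big; do 2!apply: eq_bigr => ? _.
by rewrite adjE cabs2_conj.
Qed.

Lemma tr_adj_mul m n (A : 'M[C]_(m, n)) : \tr (A ^t* *m A) = (fro2 A)%:C.
Proof.
rewrite /mxtrace fro2E exchange_big rmorph_sum; apply: eq_bigr => j _ /=.
by rewrite mxE rmorph_sum; apply: eq_bigr => i _ /=; rewrite adjE mulJ_cabs2.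
Qed.

Lemma fro2_lincomb m n (s t : R) (A B : 'M[C]_(m, n)) :
  fro2 (s%:C *: A + t%:C *: B) =
  s ^+ 2 * fro2 A + 2 * (s * t) * dot A B + t ^+ 2 * fro2 B.
Proof.
rewrite /fro2 !dotDr !dotDl !dotZr !dotZl (dotC B A); ring.
Qed.

Lemma dot_cauchy_schwarz m n (A B : 'M[C]_(m, n)) :
  dot A B ^+ 2 <= fro2 A * fro2 B.
Proof.
have H s t := fro2_ge0 (s%:C *: A + t%:C *: B).
have {}H s t : 0 <= s ^+ 2 * fro2 A + 2 * (s * t) * dot A B + t ^+ 2 * fro2 B.
  by rewrite -fro2_lincomb.
(* The last choice of weights settles [fro2 B > 0], the second [fro2 A > 0], and the first the case
   where both vanish. *)
move: (H 1 (- dot A B)) (H (dot A B) (- fro2 A)) (H (fro2 B) (- dot A B)).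
move: (fro2_ge0 A) (fro2_ge0 B); clear.
move: (fro2 A) (fro2 B) (dot A B) => a b c a0 b0 H1 H2 H3.
have [b_gt0|] := ltP 0 b; first by rewrite -(ler_pM2l b_gt0); lra.
move=> b_le0; have {b_le0 b0} b0 : b = 0 by apply/eqP; rewrite eq_le b_le0.
have [a_gt0|] := ltP 0 a; first by rewrite -(ler_pM2l a_gt0); lra.
move=> a_le0; have {a_le0 a0} a0 : a = 0 by apply/eqP; rewrite eq_le a_le0.
by rewrite a0 b0 in H1 *; lra.
Qed.

(* AM-GM with a free weight replaces Cauchy-Schwarz plus an optimisation. *)
Lemma dot_le_weighted m n (t : R) (A B : 'M[C]_(m, n)) : 0 < t ->
  dot A B <= (t * fro2 A + t^-1 * fro2 B) / 2.
Proof.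
move=> t0; have := fro2_ge0 (t%:C *: A + (-1)%:C *: B).
rewrite fro2_lincomb.
have := t0; clear; move: (fro2 A) (fro2 B) (dot A B) => a b c t0 H.
have {}H : 0 <= t^-1 * (t ^+ 2 * a + 2 * (t * -1) * c + (-1) ^+ 2 * b).
  by rewrite mulr_ge0 // invr_ge0 ltW.
have E : t^-1 * (t ^+ 2 * a + 2 * (t * -1) * c + (-1) ^+ 2 * b)
  = t * a - 2 * c + t^-1 * b by field; rewrite gt_eqF.
by rewrite E in H; lra.
Qed.

(** Parallelogram law, with [fro2 (A - B)] dropped. *)
Lemma fro2D_le m n (A B : 'M[C]_(m, n)) : fro2 (A + B) <= 2 * (fro2 A + fro2 B).
Proof.
have := fro2_ge0 (1%:C *: A + (-1)%:C *: B).
have := fro2_lincomb 1 1 A B; rewrite rmorph1 !scale1r => ->.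
rewrite -(scale1r A) -(rmorph1 (real_complex R)) fro2_lincomb rmorph1 scale1r.
by move: (fro2 A) (fro2 B) (dot A B) => a b c; lra.
Qed.

(** Complex Cauchy-Schwarz from the real one: multiplying the column of [B] by the conjugate of the
    entry [z] turns the inner product into the real number [cabs2 z], one factor of which then
    cancels. *)
Lemma cabs2_mulmx_le m n p (A : 'M[C]_(m, n)) (B : 'M[C]_(n, p)) i k :
  cabs2 ((A *m B) i k) <= (\sum_j cabs2 (A i j)) * (\sum_j cabs2 (B j k)).
Proof.
set z := (A *m B) i k.
pose u := \row_j Num.conj (A i j); pose v := \row_j (Num.conj z * B j k).
have fu : fro2 u = \sum_j cabs2 (A i j).
  by rewrite fro2E big_ord1; apply: eq_bigr => j _; rewrite mxE cabs2_conj.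
have fv : fro2 v = cabs2 z * \sum_j cabs2 (B j k).
  rewrite fro2E big_ord1 mulr_sumr; apply: eq_bigr => j _.
  by rewrite mxE cabs2M cabs2_conj.
have duv : dot u v = cabs2 z.
  have E : Num.conj z * z = \sum_j Num.conj (u 0 j) * v 0 j.
    rewrite {2}/z mxE mulr_sumr; apply: eq_bigr => j _.
    by rewrite !mxE conjCK mulrCA.
  rewrite dotE big_ord1 -[RHS]/(complex.Re (cabs2 z)%:C) -mulJ_cabs2 E Re_sum.
  apply: eq_bigr => j _.
  by case: (u 0 j) (v 0 j) => [a b] [c d] /=; rewrite mulNr opprK.
have := dot_cauchy_schwarz u v; rewrite duv fu fv.
have [->|z0] := eqVneq (cabs2 z) 0.
  by move=> _; rewrite mulr_ge0 // sumr_ge0 // => ? _; exact: cabs2_ge0.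
have zp : 0 < cabs2 z by rewrite lt_def z0 cabs2_ge0.
by rewrite expr2 mulrCA ler_pM2l.
Qed.

Lemma fro2M_le m n p (A : 'M[C]_(m, n)) (B : 'M[C]_(n, p)) :
  fro2 (A *m B) <= fro2 A * fro2 B.
Proof.
rewrite (fro2E (A *m B)) (fro2E A) mulr_suml; apply: ler_sum => i _.
rewrite fro2E exchange_big mulr_sumr; apply: ler_sum => k _.
exact: cabs2_mulmx_le.
Qed.

Lemma fro2_isometry m n p (V : 'M[C]_(m, n)) (Y : 'M[C]_(n, p)) :
  V ^t* *m V = 1%:M -> fro2 (V *m Y) = fro2 Y.
Proof.
by move=> VV; rewrite /fro2 /dot adj_mul mulmxA -(mulmxA _ _ V) VV mulmx1.
Qed.

(** Stacking the [V i] gives an isometry. This serves Kraus operators, POVM factors and the matrix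
    units [delta_mx i i] alike. *)
Lemma fro2_sum_isometry (I : finType) m n p (V : I -> 'M[C]_(m, n)) (Y : 'M[C]_(n, p)) :
  \sum_i (V i) ^t* *m V i = 1%:M -> \sum_i fro2 (V i *m Y) = fro2 Y.
Proof.
move=> VV; rewrite /fro2 /dot -Re_sum -raddf_sum; congr (complex.Re (\tr _)).
rewrite -[in RHS](mulmx1 (Y ^t*)) -VV mulmx_sumr mulmx_suml.
by apply: eq_bigr => i _; rewrite adj_mul !mulmxA.
Qed.

Lemma fro2_col (n : nat) (v : 'cV[C]_n) : fro2 v = \sum_i cabs2 (v i 0).
Proof. by rewrite fro2E; apply: eq_bigr => i _; rewrite big_ord1. Qed.

Lemma adj_mul_col (n : nat) (v : 'cV[C]_n) : v ^t* *m v = (fro2 v)%:C%:M.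
Proof. by rewrite [LHS]mx11_scalar -tr_adj_mul -trace_mx11. Qed.

End Frobenius.

(** * Spectral decomposition and the trace norm *)

Section TraceNorm.
Context {R : realType}.
Local Notation C := R[i].

Lemma hermsymmxP n (A : 'M[C]_n) : A \is hermsymmx <-> A ^t* = A.
Proof.
by split=> [/is_hermitianmxP|] E; [rewrite [RHS]E|apply/is_hermitianmxP];
  rewrite expr0 scale1r.
Qed.

Lemma is_psd_adj_mul m n (S : 'M[C]_(m, n)) : is_psd (S ^t* *m S).
Proof.
split; first by apply/hermsymmxP; rewrite adj_mul trmxCK.
move=> v; rewrite mulmxA -adj_mul -mulmxA adj_mul_col mxE eqxx mulr1n.
by rewrite ler0c fro2_ge0.
Qed.

Lemma spectralE n (A : 'M[C]_n) : A \is hermsymmx ->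
  A = (spectralmx A) ^t* *m diag_mx (spectral_diag A) *m spectralmx A.
Proof.
move=> /hermitian_normalmx /orthomx_spectralP {1}->.
by rewrite invmx_unitary ?spectral_unitarymx.
Qed.

Lemma adj_unitaryK n (P : 'M[C]_n) : P \is unitarymx -> P ^t* *m P = 1%:M.
Proof. by move=> uP; apply: mulmx1C; apply/unitarymxP. Qed.

Lemma diag_spectralE n (A : 'M[C]_n) : A \is hermsymmx ->
  spectralmx A *m A *m (spectralmx A) ^t* = diag_mx (spectral_diag A).
Proof.
move=> /spectralE {2}->; have /unitarymxP E := spectral_unitarymx A.
by rewrite !mulmxA E mul1mx -mulmxA E mulmx1.
Qed.

Lemma spectral_diag_ge0 n (A : 'M[C]_n) i : is_psd A -> 0 <= spectral_diag A 0 i.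
Proof.
move=> [hA /(_ (row i (spectralmx A) ^t*))].
have -> : spectral_diag A 0 i = (diag_mx (spectral_diag A)) i i.
  by rewrite mxE eqxx mulr1n.
rewrite -(diag_spectralE hA) trmxCK -row_mul.
suff -> : (row i (spectralmx A *m A) *m (row i (spectralmx A)) ^t*) 0 0 =
  (spectralmx A *m A *m (spectralmx A) ^t*) i i by [].
by rewrite [LHS]mxE [RHS]mxE; apply: eq_bigr => j _; rewrite !mxE.
Qed.

(** Factoring states and effects this way turns probabilities into values of [fro2]. *)
Lemma psd_factor n (A : 'M[C]_n) : is_psd A ->
  exists S : 'M[C]_n, A = S ^t* *m S.
Proof.
move=> psdA; have [hA _] := psdA.
pose r := \row_i (Num.sqrt (complex.Re (spectral_diag A 0 i)))%:C.
exists (diag_mx r *m spectralmx A).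
rewrite adj_mul -mulmxA (mulmxA _ (diag_mx r)) tr_diag_mx map_diag_mx mulmx_diag.
rewrite mulmxA; apply: (eq_trans (spectralE hA)).
suff -> : spectral_diag A = \row_i (map_mx Num.conj r 0 i * r 0 i) by [].
apply/rowP => i; rewrite !mxE mulJ_cabs2 cabs2_real.
have := spectral_diag_ge0 i psdA; case: (spectral_diag A 0 i) => a b /=.
rewrite lecE /= => /andP[/eqP-> a0].
by rewrite sqr_sqrtr.
Qed.

Lemma spectral_diag_adj_mul n (A : 'M[C]_n) i :
  complex.Re (spectral_diag (A ^t* *m A) 0 i) =
    \sum_k cabs2 ((A *m (spectralmx (A ^t* *m A)) ^t*) k i).
Proof.
have [hA _] := is_psd_adj_mul A.
set B := A *m _.
have -> : spectral_diag (A ^t* *m A) 0 i = (B ^t* *m B) i i.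
  rewrite /B adj_mul trmxCK mulmxA -(mulmxA _ _ A) diag_spectralE //.
  by rewrite mxE eqxx mulr1n.
rewrite mxE Re_sum; apply: eq_bigr => k _.
by rewrite adjE mulJ_cabs2.
Qed.

(** Operator norm at most 1, expressed through [fro2] on matrices of any width so that it applies
    directly to factors of states. *)
Definition contraction m n (W : 'M[C]_(m, n)) : Prop :=
  forall p (Y : 'M[C]_(n, p)), fro2 (W *m Y) <= fro2 Y.

(* With A^* A = Q^* D Q, the matrix Q^* D^(-1/2) Q A^* attains the trace norm;
   the inverse of 0 being 0, it is a partial isometry. *)
Lemma schatten1_polar n (A : 'M[C]_n) :
  exists2 W : 'M[C]_n, contraction (W ^t*) & schatten1 A = complex.Re (\tr (W *m A)).
Proof.
rewrite /schatten1; have E := spectral_diag_adj_mul A.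
have [hA _] := is_psd_adj_mul A; have := diag_spectralE hA.
have := spectral_unitarymx (A ^t* *m A).
move: E; set Q := spectralmx _; set D := spectral_diag _ => E uQ QAQ.
pose l i := complex.Re (D 0 i).
have l0 i : 0 <= l i by rewrite /l E sumr_ge0 // => ? _; exact: cabs2_ge0.
have DE i : D 0 i = (l i)%:C.
  have := spectral_diag_ge0 i (is_psd_adj_mul A); rewrite -/D /l.
  by case: (D 0 i) => a b; rewrite lecE /= => /andP[/eqP->].
pose r := \row_i ((Num.sqrt (l i))^-1)%:C.
have radj : (diag_mx r) ^t* = diag_mx r.
  rewrite tr_diag_mx map_diag_mx; congr diag_mx; apply/rowP => i.
  by rewrite !mxE; exact: conjc_real.
exists (Q ^t* *m diag_mx r *m Q *m A ^t*).
  move=> p Y; rewrite !adj_mul !trmxCK radj.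
  set Z := Q *m Y.
  have -> : fro2 Y = fro2 Z by rewrite fro2_isometry // adj_unitaryK.
  have -> : A *m (Q ^t* *m (diag_mx r *m Q)) *m Y
      = A *m Q ^t* *m (diag_mx r *m Z) by rewrite /Z !mulmxA.
  clearbody Z.
  (* The columns of [A *m Q ^t*] are orthogonal with the eigenvalues as squared norms, so each
     weight below amounts to [l i / l i], which is 1 or 0. *)
  have VV : (A *m Q ^t*) ^t* *m (A *m Q ^t*) = diag_mx D.
    by rewrite adj_mul trmxCK mulmxA -(mulmxA _ _ A) QAQ.
  have -> : fro2 (A *m Q ^t* *m (diag_mx r *m Z)) =
      \sum_i \sum_j l i * ((Num.sqrt (l i))^-1) ^+ 2 * cabs2 (Z i j).
    rewrite /fro2 /dot adj_mul mulmxA -(mulmxA _ _ (A *m _)) VV -mulmxA.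
    rewrite -/(dot _ (diag_mx D *m _)) dotE; apply: eq_bigr => i _.
    apply: eq_bigr => j _.
    rewrite !mul_diag_mx !mxE DE /cabs2.
    case: (Z i j) => a b /=; ring.
  rewrite fro2E; apply: ler_sum => i _; apply: ler_sum => j _.
  rewrite ler_piMl ?cabs2_ge0 //.
  have [->|ln0] := eqVneq (l i) 0; first by rewrite mul0r.
  by rewrite exprVn sqr_sqrtr // divff.
rewrite -!mulmxA mxtrace_mulC -(mulmxA (diag_mx r)) QAQ mulmx_diag Re_sum.
apply: eq_bigr => i _; rewrite !mxE eqxx mulr1n DE -rmorphM /=.
rewrite -/(l i); have [->|ln0] := eqVneq (l i) 0; first by rewrite sqrtr0 mulr0.
have sn0 : Num.sqrt (l i) != 0 by rewrite sqrtr_eq0 -ltNge lt_def ln0 l0.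
by rewrite -{3}(sqr_sqrtr (l0 i)) expr2 mulrA mulVf ?mul1r.
Qed.

(** An entry is at most the Frobenius norm, and a sum of squares of nonnegative numbers is at most
    the square of their sum. A single entry thus certifies the distance of a hard channel from the
    identity. *)
Lemma cabs2_le_schatten1 n (A : 'M[C]_n) i j :
  Num.sqrt (cabs2 (A i j)) <= schatten1 A.
Proof.
set Q := spectralmx (A ^t* *m A).
have l0 k : 0 <= complex.Re (spectral_diag (A ^t* *m A) 0 k).
  by rewrite spectral_diag_adj_mul sumr_ge0 // => ? _; exact: cabs2_ge0.
have s0 : 0 <= schatten1 A by apply: sumr_ge0 => k _; exact: sqrtr_ge0.
rewrite -(@ler_pXn2r _ 2) ?nnegrE ?sqrtr_ge0 // sqr_sqrtr ?cabs2_ge0 //.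
apply: (le_trans (cabs2_le_fro2 A i j)).
have -> : fro2 A = \sum_k complex.Re (spectral_diag (A ^t* *m A) 0 k).
  have uQ := spectral_unitarymx (A ^t* *m A).
  rewrite -(fro2_adj A) -(fro2_isometry (A ^t*) (adj_unitaryK uQ)).
  rewrite -(fro2_adj (_ *m A ^t*)) adj_mul trmxCK fro2E exchange_big.
  by apply: eq_bigr => k _ /=; rewrite spectral_diag_adj_mul.
rewrite expr2 /schatten1 mulr_suml; apply: ler_sum => k _.
rewrite -{1}(sqr_sqrtr (l0 k)) expr2 ler_wpM2l ?sqrtr_ge0 //.
rewrite (bigD1 k) //= lerDl; apply: sumr_ge0 => ? _; exact: sqrtr_ge0.
Qed.

End TraceNorm.

(** * Channels with an ancilla *)

Section Ancilla.
Context {R : realType}.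
Local Notation C := R[i].
Local Notation idx := mxtens.mxtens_index.

Definition amp a m n (A : 'M[C]_(n, m)) : 'M[C]_(a * n, a * m) :=
  mxtens.tensmx 1%:M A.

Definition block a m p (Y : 'M[C]_(a * m, p)) (i : 'I_a) : 'M[C]_(m, p) :=
  \matrix_(j, c) Y (idx (i, j)) c.

Lemma sum_mxtens (V : nmodType) a m (F : 'I_(a * m) -> V) :
  \sum_k F k = \sum_(i < a) \sum_(j < m) F (idx (i, j)).
Proof.
rewrite pair_bigA /= (reindex (@mxtens.mxtens_index a m)) /=.
  by apply: eq_bigr => -[].
by exists (@mxtens.mxtens_unindex a m) => k _;
  [exact: mxtens.mxtens_indexK | exact: mxtens.mxtens_unindexK].
Qed.

Lemma ampE a m n (A : 'M[C]_(n, m)) i j k l :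
  amp a A (idx (i, j)) (idx (k, l)) = (i == k)%:R * A j l.
Proof. by rewrite mxtens.tensmxE mxE. Qed.

Lemma amp_adj a m n (A : 'M[C]_(n, m)) : (amp a A) ^t* = amp a (A ^t*).
Proof.
rewrite /amp mxtens.trmx_tens mxtens.map_mxT.
by congr mxtens.tensmx; rewrite trmx1 map_mx1.
Qed.

Lemma amp_mul a m n p (A : 'M[C]_(p, n)) (B : 'M[C]_(n, m)) :
  amp a A *m amp a B = amp a (A *m B).
Proof. by rewrite mxtens.tensmx_mul mulmx1. Qed.

Lemma amp1 a m : amp a (1%:M : 'M[C]_m) = 1%:M.
Proof.
apply/matrixP => i j; case: (mxtens.mxtens_indexP i) => i1 i2.
case: (mxtens.mxtens_indexP j) => j1 j2; rewrite ampE !mxE.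
by rewrite (can_eq (@mxtens.mxtens_indexK a m)) xpair_eqE -natrM mulnb.
Qed.

Lemma ampD a m n (A B : 'M[C]_(n, m)) : amp a (A + B) = amp a A + amp a B.
Proof. by apply/matrixP => i j; rewrite !mxE mulrDr. Qed.

Lemma ampZ a m n c (A : 'M[C]_(n, m)) : amp a (c *: A) = c *: amp a A.
Proof. by apply/matrixP => i j; rewrite !mxE mulrCA. Qed.

Lemma ampB a m n (A B : 'M[C]_(n, m)) : amp a (A - B) = amp a A - amp a B.
Proof. by apply/matrixP => i j; rewrite !mxE mulrBr. Qed.

Lemma amp_sub_scalar a m (A : 'M[C]_m) c : amp a (A - c%:M) = amp a A - c%:M.
Proof. by rewrite ampB -!(scalemx1 _ c) ampZ amp1. Qed.

Lemma amp_sum a m n (I : finType) (A : I -> 'M[C]_(n, m)) :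
  amp a (\sum_k A k) = \sum_k amp a (A k).
Proof.
apply: (big_morph (@amp a m n)); first exact: ampD.
by apply/matrixP => i j; rewrite !mxE mulr0.
Qed.

Lemma amp_mulmxE a m n p (A : 'M[C]_(n, m)) (Y : 'M[C]_(a * m, p)) i j c :
  (amp a A *m Y) (idx (i, j)) c = (A *m block Y i) j c.
Proof.
rewrite [LHS]mxE sum_mxtens (bigD1 i) //= [X in _ + X]big1 ?addr0.
  rewrite [RHS]mxE; apply: eq_bigr => l _.
  by rewrite ampE eqxx mul1r mxE.
move=> k ki; apply: big1 => l _.
by rewrite ampE eq_sym (negbTE ki) !mul0r.
Qed.

Lemma fro2_block a m p (Y : 'M[C]_(a * m, p)) :
  fro2 Y = \sum_i fro2 (block Y i).
Proof.
rewrite fro2E sum_mxtens; apply: eq_bigr => i _; rewrite fro2E.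
by do 2!apply: eq_bigr => ? _; rewrite mxE.
Qed.

Lemma fro2_amp_mulmx a m n p (A : 'M[C]_(n, m)) (Y : 'M[C]_(a * m, p)) :
  fro2 (amp a A *m Y) = \sum_i fro2 (A *m block Y i).
Proof.
rewrite fro2_block; apply: eq_bigr => i _; congr fro2.
by apply/matrixP => j c; rewrite mxE amp_mulmxE.
Qed.

(** [amp] acts block by block, so the bound is free of the ancilla dimension, whereas
    [fro2 (amp a A)] itself is [a] times [fro2 A]. This lets the diamond distance obey the same
    estimate as the trace distance. *)
Lemma fro2_amp_le a m n p (A : 'M[C]_(n, m)) (Y : 'M[C]_(a * m, p)) :
  fro2 (amp a A *m Y) <= fro2 A * fro2 Y.
Proof.
rewrite fro2_amp_mulmx (fro2_block Y) mulr_sumr.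
by apply: ler_sum => i _; exact: fro2M_le.
Qed.

Lemma fro2_amp1 m n (A : 'M[C]_(n, m)) : fro2 (amp 1 A) = fro2 A.
Proof.
rewrite !fro2E sum_mxtens big_ord1; apply: eq_bigr => i _.
rewrite sum_mxtens big_ord1; apply: eq_bigr => j _.
by rewrite ampE eqxx mul1r.
Qed.

(** The content of [is_channel] with its witnesses exposed, since the deviation and the fidelities
    are computed from the Kraus operators. *)
Definition is_kraus m n r (A : 'I_r -> 'M[C]_(n, m)) (Phi : 'M[C]_m -> 'M[C]_n) :=
  \sum_k (A k) ^t* *m A k = 1%:M /\
  forall rho, Phi rho = \sum_k A k *m rho *m (A k) ^t*.

Lemma amp_kraus_isometry a m n r (A : 'I_r -> 'M[C]_(n, m)) :
  \sum_k (A k) ^t* *m A k = 1%:M ->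
  \sum_k (amp a (A k)) ^t* *m amp a (A k) = 1%:M.
Proof.
move=> AA; rewrite -amp1 -AA amp_sum.
by apply: eq_bigr => k _; rewrite amp_adj amp_mul.
Qed.

Lemma id_tens_kraus a m n r (A : 'I_r -> 'M[C]_(n, m)) Phi (rho : 'M[C]_(a * m)) :
  is_kraus A Phi ->
  id_tens Phi rho = \sum_k amp a (A k) *m rho *m (amp a (A k)) ^t*.
Proof.
move=> [_ PhiE]; apply/matrixP => i j; rewrite summxE.
case: (mxtens.mxtens_indexP i) => i1 i2.
case: (mxtens.mxtens_indexP j) => j1 j2.
rewrite mxE !mxtens.mxtens_indexK PhiE summxE; apply: eq_bigr => k _.
rewrite -[amp a (A k) *m rho *m _]mulmxA amp_mulmxE -[_ *m (A k) ^t*]mulmxA.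
rewrite [LHS]mxE [RHS]mxE; apply: eq_bigr => l _; congr (_ * _).
(* [amp] is block diagonal, so only the block [j1] contributes. *)
rewrite [RHS]mxE [LHS]mxE [RHS]mxE sum_mxtens (bigD1 j1) //= [X in _ + X]big1 ?addr0.
  by apply: eq_bigr => q _; rewrite !adjE ampE eqxx mul1r mxE.
move=> q1 ne; apply: big1 => q _.
by rewrite adjE ampE eq_sym (negbTE ne) mul0r conjC0 mulr0.
Qed.

(** Cyclicity of the trace; this is the probability of an outcome once state and effect are
    factored. *)
Lemma Re_tr_sandwich (n p : nat) (K : 'M[C]_(p, n)) (S : 'M[C]_n) (T : 'M[C]_p) :
  complex.Re (\tr (K *m (S ^t* *m S) *m K ^t* *m (T ^t* *m T))) =
    fro2 (T *m K *m S ^t*).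
Proof.
rewrite /fro2 /dot !adj_mul trmxCK -!mulmxA.
by rewrite (mulmxA K) [in LHS]mxtrace_mulC -!mulmxA.
Qed.

End Ancilla.

(** * Upper bound *)

Section Deviation.
Context {R : realType}.
Local Notation C := R[i].

Lemma tr_sum n (I : finType) (F : I -> 'M[C]_n) : \tr (\sum_i F i) = \sum_i \tr (F i).
Proof. exact: (raddf_sum (@mxtrace C n)). Qed.

Lemma state_factor n (rho : 'M[C]_n) : is_state rho ->
  exists2 S : 'M[C]_n, rho = S ^t* *m S & fro2 S = 1.
Proof.
move=> [/psd_factor[S ->]]; rewrite tr_adj_mul => /eqP.
by rewrite eq_complex /= => /andP[/eqP fS _]; exists S.
Qed.

(** The trace is a [dot] of [K *m S ^t*] with the contracted [L *m S ^t*]. The weight [t] stays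
    free, to be balanced after summing over Kraus operators. *)
Lemma Re_tr_contraction_le n (W K L S : 'M[C]_n) (t : R) :
  contraction (W ^t*) -> 0 < t ->
  complex.Re (\tr (W *m (K *m (S ^t* *m S) *m L ^t*))) <=
    (t * fro2 (K *m S ^t*) + t^-1 * fro2 (L *m S ^t*)) / 2.
Proof.
move=> cW t0.
have -> : complex.Re (\tr (W *m (K *m (S ^t* *m S) *m L ^t*))) =
    dot (K *m S ^t*) (W ^t* *m (L *m S ^t*)).
  rewrite dotC /dot !adj_mul !trmxCK -!mulmxA [in RHS]mxtrace_mulC -!mulmxA.
  by rewrite [in RHS]mxtrace_mulC -!mulmxA mxtrace_mulC -!mulmxA.
apply: (le_trans (dot_le_weighted _ _ t0)).
apply: ler_wpM2r; first by rewrite invr_ge0 ler0n.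
rewrite lerD2l; apply: ler_wpM2l; first by rewrite invr_ge0 ltW.
exact: cW.
Qed.

(** Writing [K k] as [a k] plus a remainder leaves two cross terms, each bounded by weighted AM-GM,
    and a multiple of [rho]. The remainders enter through their action only, so that both the Kraus
    operators and their ampliations qualify with the same [beta]. *)
Lemma schatten1_sub_id_le n r (K : 'I_r -> 'M[C]_n) (a : 'I_r -> C)
    (beta : 'I_r -> R) (delta eta t : R) (rho : 'M[C]_n) :
  \sum_k (K k) ^t* *m K k = 1%:M ->
  (forall k p (Y : 'M[C]_(n, p)),
     fro2 ((K k - (a k)%:M) *m Y) <= beta k * fro2 Y) ->
  \sum_k beta k <= delta -> \sum_k cabs2 (a k) = 1 - eta -> 0 <= eta ->
  is_state rho -> 0 < t ->
  schatten1 (\sum_k K k *m rho *m (K k) ^t* - rho) <= t * delta + t^-1 + eta.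
Proof.
move=> KK HB Hd Ha eta0 /state_factor[S -> fS] t0.
have [W cW ->] := schatten1_polar (\sum_k K k *m (S ^t* *m S) *m (K k) ^t* - S ^t* *m S).
have fS' : fro2 (S ^t*) = 1 by rewrite fro2_adj.
pose B k := K k - (a k)%:M.
have KE k : K k *m (S ^t* *m S) *m (K k) ^t* =
    B k *m (S ^t* *m S) *m (K k) ^t* +
    (a k)%:M *m (S ^t* *m S) *m (B k) ^t* + (cabs2 (a k))%:C *: (S ^t* *m S).
  have E : (K k) ^t* = (B k) ^t* + (Num.conj (a k))%:M.
    by rewrite /B adjD adjN tr_scalar_mx map_scalar_mx subrK.
  rewrite -addrA; transitivity (B k *m (S ^t* *m S) *m (K k) ^t* +
      (a k)%:M *m (S ^t* *m S) *m (K k) ^t*).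
    by rewrite -mulmxDl -mulmxDl subrK.
  congr (_ + _); rewrite E mulmxDr; congr (_ + _).
  by rewrite mul_mx_scalar mul_scalar_mx scalerA mulJ_cabs2.
(* The scalar parts add up to [(1 - eta) rho]; what is left after subtracting [rho] is put in the
   form of [Re_tr_contraction_le]. *)
have -> : \sum_k K k *m (S ^t* *m S) *m (K k) ^t* - S ^t* *m S =
  \sum_k (B k *m (S ^t* *m S) *m (K k) ^t* +
    (a k)%:M *m (S ^t* *m S) *m (B k) ^t*)
  + eta%:C *: ((-1)%:M *m (S ^t* *m S) *m 1%:M ^t*).
  under eq_bigr do rewrite KE.
  rewrite big_split /= -addrA -scaler_suml -rmorph_sum /= Ha; congr (_ + _).
  rewrite adj1 mulmx1 mul_scalar_mx scaleN1r scalerN rmorphB rmorph1.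
  by rewrite scalerBl scale1r addrAC subrr add0r.
rewrite mulmxDr mxtraceD ReD mulmx_sumr tr_sum Re_sum.
rewrite -scalemxAr mxtraceZ Re_realM; apply: lerD; last first.
  rewrite -[leRHS]mulr1 ler_wpM2l //.
  apply: (le_trans (Re_tr_contraction_le _ _ _ cW ltr01)).
  rewrite mul_scalar_mx scaleN1r fro2N mul1mx fS' invr1; lra.
have Kt : \sum_k fro2 (K k *m S ^t*) = 1 by rewrite fro2_sum_isometry.
have t'0 : 0 < t^-1 by rewrite invr_gt0.
apply: (@le_trans _ _ (\sum_k (t * beta k + t^-1 / 2 * fro2 (K k *m S ^t*) +
   t^-1 / 2 * cabs2 (a k)))).
  apply: ler_sum => k _; rewrite mulmxDr mxtraceD ReD.
  have := Re_tr_contraction_le (B k) (K k) S cW t0.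
  (* The small factor [B k] is now on the right, so the inverse weight puts [t] on it again. *)
  have := Re_tr_contraction_le (a k)%:M (B k) S cW t'0.
  have := HB k _ (S ^t*); rewrite -/(B k) fS' invrK !mul_scalar_mx fro2Z fS' => h1 h2 h3.
  have h4 : t * fro2 (B k *m S ^t*) <= t * beta k.
    by rewrite ler_pM2l // -[beta k]mulr1.
  apply: (le_trans (lerD h3 h2)); move: h4.
  by clear; move: (fro2 (B k *m _)) (fro2 (K k *m _)) => f g h4; lra.
rewrite !big_split /= -!mulr_sumr Kt Ha.
have h4 : t * (\sum_k beta k) <= t * delta by rewrite ler_pM2l.
have : 0 <= t^-1 * eta by rewrite mulr_ge0 // ltW.
lra.
Qed.

(** Triangle inequality between two states, by duality with [W]. *)
Lemma schatten1_sub_id_le2 n r (K : 'I_r -> 'M[C]_n) (rho : 'M[C]_n) :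
  \sum_k (K k) ^t* *m K k = 1%:M -> is_state rho ->
  schatten1 (\sum_k K k *m rho *m (K k) ^t* - rho) <= 2.
Proof.
move=> KK /state_factor[S -> fS].
have [W cW ->] := schatten1_polar (\sum_k K k *m (S ^t* *m S) *m (K k) ^t* - S ^t* *m S).
have fS' : fro2 (S ^t*) = 1 by rewrite fro2_adj.
have -> : - (S ^t* *m S) = (-1)%:M *m (S ^t* *m S) *m 1%:M ^t*.
  by rewrite adj1 mulmx1 mul_scalar_mx scaleN1r.
rewrite mulmxDr mxtraceD ReD mulmx_sumr tr_sum Re_sum.
have h1 := Re_tr_contraction_le (-1)%:M 1%:M S cW ltr01.
rewrite !mul_scalar_mx scale1r !scaleN1r fro2N fS' invr1 in h1.
have h2 : \sum_k complex.Re (\tr (W *m (K k *m (S ^t* *m S) *m (K k) ^t*))) <=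
    \sum_k fro2 (K k *m S ^t*).
  apply: ler_sum => k _.
  have := Re_tr_contraction_le (K k) (K k) S cW ltr01.
  by rewrite invr1; move: (fro2 _) (complex.Re _) => f x; lra.
move: h2; rewrite (fro2_sum_isometry _ KK) fS' mul_scalar_mx scaleN1r => h2.
by apply: (le_trans (lerD h2 h1)); lra.
Qed.

(** The default value 0 of [sup] on the empty set is the reason for [0 <= b]. *)
Lemma sup_le_nneg (E : set R) (b : R) : 0 <= b -> (forall x, E x -> x <= b) -> sup E <= b.
Proof.
move=> b0 Eb; have [->|/set0P E0] := eqVneq E set0; first by rewrite sup0.
exact: ge_sup.
Qed.

Definition mean_diag d (A : 'M[C]_d) : C := \tr A / d%:R.

(** For the Kraus operators of a channel, this is [d] times one minus the entanglement fidelity with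
    the identity. *)
Definition deviation d r (A : 'I_r -> 'M[C]_d) : R :=
  \sum_k fro2 (A k - (mean_diag (A k))%:M).

Lemma fro2D_orth m n (A B : 'M[C]_(m, n)) :
  dot A B = 0 -> fro2 (A + B) = fro2 A + fro2 B.
Proof. by move=> AB; rewrite /fro2 dotDl !dotDr (dotC B A) AB addr0 add0r. Qed.

(** Pythagoras: [A] minus its mean diagonal has trace 0, hence is orthogonal to the scalars. *)
Lemma fro2_mean_diag d (A : 'M[C]_d) : (0 < d)%N ->
  fro2 A = fro2 (A - (mean_diag A)%:M) + d%:R * cabs2 (mean_diag A).
Proof.
move=> d0; set m := mean_diag A.
have dn0 : (d%:R : C) != 0 by rewrite pnatr_eq0 -lt0n.
have E : A = (A - m%:M) + m%:M by rewrite subrK.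
have fm : fro2 (m%:M : 'M[C]_d) = d%:R * cabs2 m.
  rewrite /fro2 /dot tr_scalar_mx map_scalar_mx -scalar_mxM mxtrace_scalar.
  by rewrite mulJ_cabs2 -rmorphMn /= mulr_natl.
rewrite -fm {1}E; apply: fro2D_orth.
rewrite /dot mul_mx_scalar mxtraceZ -map_trmx mxtrace_tr.
rewrite -[X in _ * X]/(\tr (map_mx Num.conj _)) trace_map_mx.
rewrite (raddfB (@mxtrace C d)) /= mxtrace_scalar /= /m /mean_diag.
rewrite -(mulr_natr (_ / _)) divfK // subrr.
by rewrite conjC0 mulr0.
Qed.

Lemma sum_fro2_kraus d r (A : 'I_r -> 'M[C]_d) :
  \sum_k (A k) ^t* *m A k = 1%:M -> \sum_k fro2 (A k) = d%:R.
Proof.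
move=> AA; rewrite /fro2 /dot -Re_sum -tr_sum AA mxtrace1.
by rewrite -(rmorph_nat (real_complex R)).
Qed.

Lemma deviation_ge0 d r (A : 'I_r -> 'M[C]_d) : 0 <= deviation A.
Proof. by apply: sumr_ge0 => k _; exact: fro2_ge0. Qed.

Lemma sum_mean_diag d r (A : 'I_r -> 'M[C]_d) : (0 < d)%N ->
  \sum_k (A k) ^t* *m A k = 1%:M ->
  \sum_k cabs2 (mean_diag (A k)) = 1 - deviation A / d%:R.
Proof.
move=> d0 /sum_fro2_kraus.
have dn0 : (d%:R : R) != 0 by rewrite pnatr_eq0 -lt0n.
under eq_bigr do rewrite fro2_mean_diag //.
rewrite big_split /= -/(deviation A) -mulr_sumr => E.
apply: (mulfI dn0); rewrite mulrBr mulr1 mulrCA divff // mulr1.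
by apply/eqP; rewrite eq_sym subr_eq addrC E.
Qed.

Lemma id_tens_sub_idfun a d r (A : 'I_r -> 'M[C]_d) Phi (rho : 'M[C]_(a * d)) :
  is_kraus A Phi ->
  id_tens (fun X => Phi X - idfun X) rho =
    \sum_k amp a (A k) *m rho *m (amp a (A k)) ^t* - rho.
Proof.
move=> KA; rewrite -(id_tens_kraus rho KA); apply/matrixP => i j.
case: (mxtens.mxtens_indexP i) => i1 i2.
case: (mxtens.mxtens_indexP j) => j1 j2.
by rewrite !mxE !mxtens.mxtens_indexK !mxE.
Qed.

Lemma deviation_lower d r (A : 'I_r -> 'M[C]_d) Phi eps : (0 < d)%N ->
  is_kraus A Phi -> 0 < eps ->
  eps <= trace_dist Phi idfun \/ eps <= diamond_dist Phi idfun ->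
  eps <= 2 /\ eps ^+ 2 <= 8 * deviation A.
Proof.
move=> d0 KA eps0 Heps.
have [AA PhiE] := KA.
have dev0 := deviation_ge0 A.
have d1 : (1 : R) <= d%:R by rewrite ler1n.
have eta0 : 0 <= deviation A / d%:R by rewrite divr_ge0 // ler0n.
have etale : deviation A / d%:R <= deviation A.
  by rewrite ler_pdivrMr ?(lt_le_trans ltr01) // ler_peMr.
have Hb b : 0 <= b ->
    (forall rho, is_state rho -> schatten1 (Phi rho - rho) <= b) ->
    (forall rho, is_state rho ->
      schatten1 (@id_tens _ d d d (fun X => Phi X - idfun X) rho) <= b) -> eps <= b.
  move=> b0 H1 H2; case: Heps => /le_trans; apply; apply: sup_le_nneg => // x.
    by move=> [rho Hrho <-]; exact: H1.
  by move=> [rho Hrho <-]; exact: H2.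
have idtE rho := id_tens_sub_idfun rho KA.
have AA' := amp_kraus_isometry d AA.
have eps2 : eps <= 2.
  apply: Hb => // rho Hrho; first by rewrite PhiE; exact: schatten1_sub_id_le2.
  by rewrite idtE; exact: schatten1_sub_id_le2.
split=> //.
(* With [t = 2 / eps] the term [t^-1] is [eps / 2], which the left side absorbs. *)
have t0 : 0 < 2 / eps by rewrite divr_gt0.
have : eps <= 2 / eps * deviation A + (2 / eps)^-1 + deviation A / d%:R.
  apply: Hb.
  - by rewrite !addr_ge0 // ?mulr_ge0 // ?invr_ge0 ltW.
  - move=> rho Hrho; rewrite PhiE.
    apply: (@schatten1_sub_id_le _ _ A (fun k => mean_diag (A k))
      (fun k => fro2 (A k - (mean_diag (A k))%:M))) => //.
      by move=> k p Y; exact: fro2M_le.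
    exact: sum_mean_diag.
  - move=> rho Hrho; rewrite idtE.
    apply: (@schatten1_sub_id_le _ _ (fun k => amp d (A k)) (fun k => mean_diag (A k))
      (fun k => fro2 (A k - (mean_diag (A k))%:M))) => //.
      move=> k p Y; rewrite -amp_sub_scalar.
      exact: fro2_amp_le.
    exact: sum_mean_diag.
rewrite invf_div => H.
have {}H : eps <= 2 / eps * deviation A + eps / 2 + deviation A by lra.
have : eps * eps <= eps * (2 / eps * deviation A + eps / 2 + deviation A).
  by rewrite ler_pM2l.
have -> : eps * (2 / eps * deviation A + eps / 2 + deviation A) =
  2 * deviation A + eps * eps / 2 + eps * deviation A by field; rewrite gt_eqF.
(* As [eps <= 2], half of [eps ^+ 2] is at most four times the deviation. *)
rewrite expr2; nra.
Qed.

End Deviation.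

(** * Probe vectors and how far a Kraus operator moves them *)

Section Probes.
Context {R : realType}.
Local Notation C := R[i].

(** For a unit vector, the squared norm of the component of [A *m phi] orthogonal to [phi]; summed
    over Kraus operators, the probability of failing the test. *)
Definition rejection d (A : 'M[C]_d) (phi : 'cV[C]_d) : R :=
  fro2 (A *m phi) - cabs2 ((phi ^t* *m A *m phi) 0 0).

Lemma rejection_ge0 d (A : 'M[C]_d) phi : fro2 phi = 1 -> 0 <= rejection A phi.
Proof.
move=> f1; rewrite subr_ge0 -mulmxA.
apply: (le_trans (cabs2_mulmx_le _ _ _ _)).
have -> : \sum_j cabs2 ((phi ^t*) 0 j) = 1.
  by rewrite -f1 fro2_col; apply: eq_bigr => j _; rewrite adjE cabs2_conj.
by rewrite mul1r -fro2_col.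
Qed.

Definition basis_vec d (i : 'I_d) : 'cV[C]_d := delta_mx i 0.

Definition pair_vec d (s : bool) (i j : 'I_d) : 'cV[C]_d :=
  ((Num.sqrt 2)^-1)%:C *: (basis_vec i + (-1) ^+ s *: basis_vec j).

Lemma basis_vec_adj_mul d i p (M : 'M[C]_(d, p)) : (basis_vec i) ^t* *m M = row i M.
Proof. by rewrite rowE trmx_delta map_delta_mx. Qed.

Lemma fro2_basis_vec d (i : 'I_d) : fro2 (basis_vec i) = 1.
Proof.
rewrite fro2_col (bigD1 i) //= big1 ?addr0 => [|k ki]; rewrite mxE ?eqxx.
  by rewrite /cabs2 /= expr1n expr0n addr0.
by rewrite (negbTE ki) /cabs2 /= expr0n addr0.
Qed.

Lemma cabs2_sqrt2V : cabs2 ((Num.sqrt 2)^-1)%:C = 2^-1 :> R.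
Proof. by rewrite cabs2_real exprVn sqr_sqrtr. Qed.

Lemma fro2_pair_vec d s (i j : 'I_d) : i != j -> fro2 (pair_vec s i j) = 1.
Proof.
move=> ij; rewrite fro2Z cabs2_sqrt2V fro2_col (bigD1 i) //= (bigD1 j) 1?eq_sym //=.
rewrite big1 => [|k /andP[ki kj]].
  rewrite !mxE !eqxx (negbTE ij) (eq_sym j) (negbTE ij) /= mulr0 mulr1 add0r addr0.
  by case: s; rewrite /cabs2 /=; field.
by rewrite !mxE (negbTE ki) (negbTE kj) /= mulr0 addr0 /cabs2 /= expr0n addr0.
Qed.

Lemma rejection_basis_vec d (A : 'M[C]_d) i :
  rejection A (basis_vec i) = \sum_(l | l != i) cabs2 (A l i).
Proof.
rewrite /rejection basis_vec_adj_mul -row_mul -colE fro2_col (bigD1 i) //=.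
rewrite !mxE addrAC subrr add0r.
by apply: eq_bigr => l _; rewrite mxE.
Qed.

(** For each sign, only the component of the image along the pair vector of opposite sign is kept.
    It contains [A i i - A j j] plus or minus [A i j - A j i], and adding the two signs cancels the
    cross term. *)
Lemma rejection_pair_vec d (A : 'M[C]_d) (i j : 'I_d) : i != j ->
  2^-1 * cabs2 (A i i - A j j) <=
    \sum_(s : bool) rejection A (pair_vec s i j).
Proof.
move=> ij.
have H (s : bool) : 4^-1 * cabs2 (A i i + (-1) ^+ s * A i j
    - (-1) ^+ s * (A j i + (-1) ^+ s * A j j)) <= rejection A (pair_vec s i j).
  rewrite /rejection /pair_vec; set w := basis_vec i + _.
  rewrite adjZ -!scalemxAr -!scalemxAl fro2Z.
  have sE (a : C) (M : 'M[C]_(1, 1)) : (a *: M) 0 0 = a * M 0 0 by rewrite mxE.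
  rewrite !sE.
  rewrite !cabs2M cabs2_conj cabs2_sqrt2V.
  have Aw l : (A *m w) l 0 = A l i + (-1) ^+ s * A l j.
    by rewrite mulmxDr -scalemxAr -!colE !mxE.
  have -> : (w ^t* *m A *m w) 0 0 = (A *m w) i 0 + (-1) ^+ s * (A *m w) j 0.
    rewrite -mulmxA adjD adjZ mulmxDl -scalemxAl !basis_vec_adj_mul !mxE.
    by case: s @w Aw => w _ /=; rewrite ?expr1 ?expr0 ?rmorphN1 ?rmorph1.
  have Hf : cabs2 ((A *m w) i 0) + cabs2 ((A *m w) j 0) <= fro2 (A *m w).
    rewrite fro2_col (bigD1 i) //= (bigD1 j) 1?eq_sym //= addrA lerDl.
    by apply: sumr_ge0 => ? _; exact: cabs2_ge0.
  rewrite -!Aw; move: Hf; set x := (A *m w) i 0; set y := (A *m w) j 0.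
  have : cabs2 (x + (-1) ^+ s * y) + cabs2 (x - (-1) ^+ s * y) =
      2 * cabs2 x + 2 * cabs2 y.
    by case: s @w Aw @x @y => w _ x y; rewrite ?expr1 ?expr0 /cabs2;
      case: x y => [a b] [c e] /=; ring.
  lra.
rewrite big_bool; apply: le_trans (lerD (H true) (H false)).
rewrite expr0 expr1; move: (A i i) (A i j) (A j i) (A j j).
move=> [a1 a2] [b1 b2] [c1 c2] [e1 e2]; rewrite /cabs2 /=.
have := sqr_ge0 (b1 - c1); have := sqr_ge0 (b2 - c2); nra.
Qed.

(** Variance identity: centring at the mean makes the cross terms sum to 0. *)
Lemma sum_pair_cabs2 d (z : 'I_d -> C) : (0 < d)%N ->
  \sum_i \sum_j cabs2 (z i - z j) =
    2 * d%:R * \sum_i cabs2 (z i - (\sum_l z l) / d%:R).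
Proof.
move=> d0; have dn0 : (d%:R : R) != 0 by rewrite pnatr_eq0 -lt0n.
have dC0 : (d%:R : C) != 0 by rewrite pnatr_eq0 -lt0n.
set m := _ / _; pose y i := z i - m.
have y0 : \sum_i y i = 0.
  rewrite big_split /= sumr_const card_ord mulNrn -[X in _ - X]mulr_natr.
  by rewrite divfK // subrr.
have E i j : cabs2 (z i - z j) = cabs2 (y i) + cabs2 (y j)
    - 2 * complex.Re (Num.conj (y i) * y j).
  have -> : z i - z j = y i - y j by rewrite /y; ring.
  by case: (y i) (y j) => [a b] [c e]; rewrite /cabs2 /=; ring.
under eq_bigr => i _.
  under eq_bigr do rewrite E.
  rewrite big_split big_split /= sumrN -mulr_sumr -Re_sum -mulr_sumr y0 mulr0 /=.
  rewrite mulr0 subr0 sumr_const card_ord.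
  over.
rewrite big_split /= sumr_const card_ord sumrMnl -mulr_natl -[X in _ + X]mulr_natl.
by rewrite /y; ring.
Qed.

Lemma sum_prod (V : nmodType) (I J : finType) (F : I * J -> V) :
  \sum_p F p = \sum_i \sum_j F (i, j).
Proof. by rewrite pair_bigA; apply: eq_bigr => -[]. Qed.

(** The first flag separates basis vectors from pairs, and the second is the sign. Each basis vector
    occurs [2 * d] times under the first flag, so a uniform draw gives both families comparable
    weight. *)
Definition probe_index d : finType := (bool * bool * ('I_d * 'I_d))%type.

(** For [i = j] a pair vector would be 0 or have norm [Num.sqrt 2], hence the fallback to a basis
    vector. *)
Definition probe d (x : probe_index d) : 'cV[C]_d :=
  let: (b, s, (i, j)) := x in
  if b || (i == j) then basis_vec i else pair_vec s i j.

Lemma fro2_probe d (x : probe_index d) : fro2 (probe x) = 1.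
Proof.
case: x => -[[] s] [i j] /=; first exact: fro2_basis_vec.
by have [|ij] := eqVneq; [rewrite fro2_basis_vec | exact: fro2_pair_vec].
Qed.

Lemma sum_rejection_probe d (A : 'M[C]_d) : (0 < d)%N ->
  d%:R * fro2 (A - (mean_diag A)%:M) <= \sum_x rejection A (@probe d x).
Proof.
move=> d0.
pose off := \sum_i \sum_(l | l != i) cabs2 (A l i).
pose dg := \sum_i cabs2 (A i i - mean_diag A).
have -> : fro2 (A - (mean_diag A)%:M) = dg + off.
  rewrite fro2E exchange_big /dg /off -big_split; apply: eq_bigr => i _ /=.
  rewrite (bigD1 i) //= !mxE eqxx mulr1n; congr (_ + _).
  by apply: eq_bigr => l li; rewrite !mxE (negbTE li) mulr0n subr0.
have off0 : 0 <= off by do 2!apply: sumr_ge0 => ? _; exact: cabs2_ge0.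
have dgE : d%:R * dg = \sum_i \sum_j 2^-1 * cabs2 (A i i - A j j).
  under eq_bigr do rewrite -mulr_sumr.
  rewrite -mulr_sumr sum_pair_cabs2 // /dg /mean_diag /mxtrace.
  by rewrite !mulrA mulVf // mul1r.
rewrite !sum_prod big_bool mulrDr dgE addrC; apply: lerD.
  (* Basis vectors: the copies with a single sign already give [d%:R * off]. *)
  rewrite big_bool /= !sum_prod /=.
  have -> : \sum_i \sum_(j < d) rejection A (basis_vec i) = d%:R * off.
    rewrite /off mulr_sumr; apply: eq_bigr => i _.
    by rewrite sumr_const card_ord mulr_natl rejection_basis_vec.
  by rewrite lerDl mulr_ge0 // ler0n.
(* Pairs: both signs are needed for each [(i, j)], so the sum over signs is moved inside. *)
rewrite pair_bigA [leRHS]exchange_big; apply: ler_sum => -[i j] _ /=.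
have [->|ij] := eqVneq i j.
  rewrite subrr {1}/cabs2 /= expr0n addr0 mulr0.
  by apply: sumr_ge0 => s _; apply: rejection_ge0; exact: fro2_basis_vec.
exact: rejection_pair_vec.
Qed.

End Probes.

(** * The ancilla-free test and its error *)

Section IdentityTest.
Context {R : realType}.
Local Notation C := R[i].

Lemma psd_scale n (q : R) (A : 'M[C]_n) : 0 <= q -> is_psd A -> is_psd (q%:C *: A).
Proof.
move=> q0 /psd_factor[S ->].
have -> : q%:C *: (S ^t* *m S) =
    ((Num.sqrt q)%:C *: S) ^t* *m ((Num.sqrt q)%:C *: S).
  by rewrite adjZ -scalemxAl -scalemxAr scalerA mulJ_cabs2 cabs2_real sqr_sqrtr.
exact: is_psd_adj_mul.
Qed.

Definition proj n p (V : 'M[C]_(n, p)) : 'M[C]_n := V *m V ^t*.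

Lemma is_psd_proj n p (V : 'M[C]_(n, p)) : is_psd (proj V).
Proof. by rewrite /proj -{1}(trmxCK V); exact: is_psd_adj_mul. Qed.

Lemma is_psd_proj_compl n p (V : 'M[C]_(n, p)) :
  V ^t* *m V = 1%:M -> is_psd (1%:M - proj V).
Proof.
move=> VV; suff -> : 1%:M - proj V = (1%:M - proj V) ^t* *m (1%:M - proj V).
  exact: is_psd_adj_mul.
rewrite adjD adjN adj1 /proj adj_mul trmxCK mulmxBr mulmx1 mulmxBl mul1mx.
by rewrite mulmxA -(mulmxA V) VV mulmx1 subrr subr0.
Qed.

(** Strategies act in dimension [danc * din]; tensoring with the trivial ancilla moves [phi] to
    [1 * d] and makes the [amp] lemmas available. *)
Definition lift_vec d (phi : 'cV[C]_d) : 'M[C]_(1 * d, 1 * 1) := amp 1 phi.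

Lemma lift_vec_isometry d (phi : 'cV[C]_d) : fro2 phi = 1 ->
  (lift_vec phi) ^t* *m lift_vec phi = 1%:M.
Proof. by move=> f1; rewrite amp_adj amp_mul adj_mul_col f1 rmorph1 amp1. Qed.

Lemma is_state_proj n (V : 'M[C]_(n, 1)) :
  V ^t* *m V = 1%:M -> is_state (proj V).
Proof.
by move=> VV; split; [exact: is_psd_proj | rewrite mxtrace_mulC VV mxtrace1].
Qed.

Definition test_state d (x : probe_index d) : 'M[C]_(1 * d) := proj (lift_vec (probe x)).

(** Splitting each of the two effects into equal parts attaches to the verdict a uniform label,
    independent of the channel. *)
Definition test_povm d (x : probe_index d) (o : bool * probe_index d) : 'M[C]_(1 * d) :=
  ((#|probe_index d|%:R)^-1)%:C *:
    (if o.1 then proj (lift_vec (probe x)) else 1%:M - proj (lift_vec (probe x))).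

Lemma is_state_test_state d (x : probe_index d) : is_state (test_state x).
Proof. by apply: is_state_proj; apply: lift_vec_isometry; exact: fro2_probe. Qed.

Lemma is_povm_test_povm d (x : probe_index d) : is_povm (test_povm x).
Proof.
have VV := lift_vec_isometry (fro2_probe (R := R) x).
split=> [[b y]|].
  apply: psd_scale; first by rewrite invr_ge0 ler0n.
  by case: b => /=; [exact: is_psd_proj | exact: is_psd_proj_compl].
rewrite sum_prod /test_povm big_bool /= !sumr_const -mulrnDl -scalerDr addrC subrK.
rewrite -scaler_nat scalerA -[X in X * _](rmorph_nat (real_complex R)) -rmorphM.
rewrite divff ?rmorph1 ?scale1r // pnatr_eq0 -lt0n; apply/card_gt0P.
by exists x.
Qed.

(* Each measurement tests the current probe and draws the next probe uniformly,
   so no internal randomness is needed; [v] becomes [H1] once a probe fails. *)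
Fixpoint identity_test d N (v : hypothesis) (x : probe_index d) : strategy R d d N :=
  match N with
  | 0 => @Answer R d d v
  | N'.+1 => @Measurement R d d N' 1 _ _ _ (is_state_test_state x)
      (is_povm_test_povm x) (fun o => identity_test N' (if o.1 then v else H1) o.2)
  end.

Lemma identity_test_ancilla_free d N v (x : probe_index d) :
  ancilla_free (identity_test N v x).
Proof. by elim: N v x => //= N IH v x; split=> // o; exact: IH. Qed.

Lemma answer_prob_identity_test_H1 d N (x : probe_index d) Phi :
  answer_prob (identity_test N H1 x) Phi H0 = 0.
Proof.
elim: N x => //= N IH x; apply: big1 => o _.
by case: o.1; rewrite IH mulr0.
Qed.

Definition fidelity d r (A : 'I_r -> 'M[C]_d) (phi : 'cV[C]_d) : R :=
  \sum_k cabs2 ((phi ^t* *m A k *m phi) 0 0).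

Definition mean_fidelity d r (A : 'I_r -> 'M[C]_d) : R :=
  (#|probe_index d|%:R)^-1 * \sum_(y : probe_index d) fidelity A (probe y).

Lemma fidelity_probeE d r (A : 'I_r -> 'M[C]_d) Phi (x : probe_index d) :
  is_kraus A Phi ->
  complex.Re (\tr (id_tens Phi (test_state x) *m proj (lift_vec (probe x)))) =
    fidelity A (probe x).
Proof.
move=> KA; rewrite (id_tens_kraus _ KA) mulmx_suml tr_sum Re_sum.
apply: eq_bigr => k _; rewrite /test_state /proj.
set V := lift_vec _.
have -> : complex.Re (\tr (amp 1 (A k) *m (V *m V ^t*) *m (amp 1 (A k)) ^t* *m (V *m V ^t*)))
    = fro2 (V ^t* *m amp 1 (A k) *m V).
  rewrite /fro2 /dot !adj_mul !trmxCK -!mulmxA (mulmxA (amp 1 (A k))).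
  by rewrite [in LHS]mxtrace_mulC -!mulmxA.
by rewrite /V /lift_vec amp_adj !amp_mul fro2_amp1 fro2E !big_ord1.
Qed.

(** Accepting requires all probes to pass. The first probe is fixed, whence its own fidelity; the
    [N] later ones are independent and uniform, whence the power. *)
Lemma answer_prob_identity_test d r (A : 'I_r -> 'M[C]_d) Phi N (x : probe_index d) :
  is_kraus A Phi ->
  answer_prob (identity_test N.+1 H0 x) Phi H0 =
    fidelity A (probe x) * mean_fidelity A ^+ N.
Proof.
move=> KA.
have step M (y : probe_index d) : answer_prob (identity_test M.+1 H0 y) Phi H0 =
    fidelity A (probe y) * ((#|probe_index d|%:R)^-1 *
      \sum_(z : probe_index d) answer_prob (identity_test M H0 z) Phi H0).
  rewrite /= sum_prod big_bool /= [X in _ + X]big1 ?addr0 => [|z _]; last first.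
    by rewrite answer_prob_identity_test_H1 mulr0.
  rewrite mulrA mulr_sumr; apply: eq_bigr => z _; congr (_ * _).
  by rewrite /test_povm /= -scalemxAr mxtraceZ Re_realM (fidelity_probeE _ KA) mulrC.
elim: N x => [|N IH] x; rewrite step.
  rewrite /= sumr_const expr0 -[1 *+ _]/(_%:R) mulVf // pnatr_eq0 -lt0n.
  by apply/card_gt0P; exists x.
congr (_ * _); rewrite exprS /mean_fidelity -mulrA; congr (_ * _).
by rewrite mulr_suml; apply: eq_bigr => z _; rewrite IH.
Qed.

Lemma fidelity_rejection d r (A : 'I_r -> 'M[C]_d) (phi : 'cV[C]_d) :
  \sum_k (A k) ^t* *m A k = 1%:M -> fro2 phi = 1 ->
  fidelity A phi = 1 - \sum_k rejection (A k) phi.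
Proof.
move=> AA f1; rewrite sumrB fro2_sum_isometry // f1.
by rewrite opprB addrCA subrr addr0.
Qed.

Lemma fidelity_ge0 d r (A : 'I_r -> 'M[C]_d) phi : 0 <= fidelity A phi.
Proof. by apply: sumr_ge0 => k _; exact: cabs2_ge0. Qed.

Lemma fidelity_le1 d r (A : 'I_r -> 'M[C]_d) phi :
  \sum_k (A k) ^t* *m A k = 1%:M -> fro2 phi = 1 -> fidelity A phi <= 1.
Proof.
move=> AA f1; rewrite fidelity_rejection // lerBlDr lerDl.
by apply: sumr_ge0 => k _; exact: rejection_ge0.
Qed.

Lemma mean_fidelity_ge0 d r (A : 'I_r -> 'M[C]_d) : 0 <= mean_fidelity A.
Proof.
rewrite mulr_ge0 ?invr_ge0 ?ler0n // sumr_ge0 // => y _; exact: fidelity_ge0.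
Qed.

(** The rejections add up to at least [d] times the deviation, over [4 * d ^ 2] probes. *)
Lemma mean_fidelity_le d r (A : 'I_r -> 'M[C]_d) : (0 < d)%N ->
  \sum_k (A k) ^t* *m A k = 1%:M ->
  mean_fidelity A <= 1 - deviation A / (4 * d%:R).
Proof.
move=> d0 AA.
have dp : (0 : R) < d%:R by rewrite ltr0n.
have cardE : (#|probe_index d|%:R : R) = 4 * d%:R ^+ 2.
  by rewrite !card_prod card_bool card_ord !natrM expr2.
have S : d%:R * deviation A <= \sum_(y : probe_index d) \sum_k rejection (A k) (probe y).
  rewrite exchange_big mulr_sumr; apply: ler_sum => k _.
  exact: sum_rejection_probe.
rewrite /mean_fidelity.
under eq_bigr do rewrite (fidelity_rejection AA (fro2_probe _)).
rewrite sumrB sumr_const cardE mulrBr mulVf ?mulf_neq0 ?expf_neq0 ?gt_eqF //.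
rewrite lerD2l lerN2.
have -> : deviation A / (4 * d%:R) = (4 * d%:R ^+ 2)^-1 * (d%:R * deviation A).
  by field; rewrite gt_eqF.
by rewrite ler_pM2l // invr_gt0 mulr_gt0 ?exprn_gt0.
Qed.

(** [F ^+ n] is at most [expR (- 2)], and [expR 2] is at least [1 + 2]. *)
Lemma exp_third (F : R) (n : nat) (eta : R) :
  0 <= F -> F <= 1 - eta -> 2 <= n%:R * eta -> F ^+ n <= 1 / 3.
Proof.
move=> F0 Fle neta.
have Fe : F <= expR (- eta) by apply: le_trans (expR_ge1Dx _).
have : F ^+ n <= expR (- eta) ^+ n by rewrite lerXn2r ?nnegrE ?expR_ge0.
move/le_trans; apply; rewrite -expRM_natl mulrN expRN div1r.
rewrite lef_pV2 ?posrE ?expR_gt0 //.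
apply: le_trans (expR_ge1Dx _); lra.
Qed.

Lemma identity_test_sound d r (A : 'I_r -> 'M[C]_d) Phi N (x : probe_index d) eps :
  (0 < d)%N -> is_kraus A Phi -> 0 < eps ->
  eps <= trace_dist Phi idfun \/ eps <= diamond_dist Phi idfun ->
  576 * d%:R / eps ^+ 2 <= N%:R \/ 576 * d%:R / eps ^+ 4 <= N%:R ->
  answer_prob (identity_test N H0 x) Phi H0 <= 1 / 3.
Proof.
move=> d0 KA eps0 Heps HN.
have [eps2 dev] := deviation_lower d0 KA eps0 Heps.
have dp : (1 : R) <= d%:R by rewrite ler1n.
have e2 : 0 < eps ^+ 2 by rewrite exprn_gt0.
have e24 : eps ^+ 2 <= 4 by nra.
(* As [eps ^+ 2 <= 4], either sample size gives this bound, 144 being [576 / 4]. *)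
have {HN} HN : 144 * d%:R <= N%:R * eps ^+ 2.
  case: HN => HN.
    move: HN; rewrite ler_pdivrMr //; lra.
  move: HN; rewrite ler_pdivrMr ?exprn_gt0 // -[4%N]/(2 * 2)%N exprM => HN.
  have e44 : eps ^+ 2 ^+ 2 <= 4 * eps ^+ 2 by rewrite expr2 ler_pM2r.
  have := ler_wpM2l (ler0n R N) e44; lra.
have N36 : (36 : R) <= N%:R.
  have : N%:R * eps ^+ 2 <= N%:R * 4 by rewrite ler_wpM2l.
  lra.
case: N HN N36 => [|N] HN N36; first by move: N36; lra.
rewrite (answer_prob_identity_test _ _ KA); have [AA _] := KA.
apply: (@le_trans _ _ (mean_fidelity A ^+ N)).
  by rewrite ler_piMl ?exprn_ge0 ?mean_fidelity_ge0 ?fidelity_le1 ?fro2_probe.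
apply: (@exp_third _ _ (deviation A / (4 * d%:R))).
- exact: mean_fidelity_ge0.
- exact: mean_fidelity_le.
rewrite mulrA ler_pdivlMr ?mulr_gt0 ?(lt_le_trans ltr01 dp) //.
(* Losing the first measurement costs at most a factor 2, and the deviation is at least
   [eps ^+ 2 / 8]: their product over the remaining rounds is at least [9 * d], above the [8 * d]
   required. *)
rewrite -natr1 in HN N36.
have := ler_wpM2l (ler0n R N) dev.
have : (N%:R + 1) * eps ^+ 2 <= 2 * N%:R * eps ^+ 2 by rewrite ler_pM2r //; lra.
lra.
Qed.

(** A constant seed, drawn from a Dirac mass, embeds a deterministic strategy. *)
Definition trivial_algorithm d N (s : strategy R d d N) : algorithm R d d N :=
  @Algorithm R d d N _ _ (dirac (0 : R) : probability _ R) (fun=> s)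
    (fun _ _ _ => measurable_cst _).

Lemma output_prob_trivial d N (s : strategy R d d N) Phi h :
  output_prob (trivial_algorithm s) Phi h = (answer_prob s Phi h)%:E.
Proof.
have E := integral_cst (seed_law (trivial_algorithm s)) measurableT
  (answer_prob s Phi h)%:E.
apply: (eq_trans E); rewrite -[RHS]mule1; congr (_ * _)%E.
exact: probability_setT.
Qed.

End IdentityTest.

(** * Lower bound *)

Section LowerBound.
Context {R : realType}.
Local Notation C := R[i].

Definition step_prob a m n (Phi : 'M[C]_m -> 'M[C]_n) (rho : 'M[C]_(a * m))
    (M : 'M[C]_(a * n)) : R := complex.Re (\tr (id_tens Phi rho *m M)).

Lemma step_prob_kraus a m n r (A : 'I_r -> 'M[C]_(n, m)) Phi
    (S : 'M[C]_(a * m)) (T : 'M[C]_(a * n)) : is_kraus A Phi ->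
  step_prob Phi (S ^t* *m S) (T ^t* *m T) =
    \sum_k fro2 (T *m (amp a (A k) *m S ^t*)).
Proof.
move=> KA; rewrite /step_prob (id_tens_kraus _ KA) mulmx_suml tr_sum Re_sum.
by apply: eq_bigr => k _; rewrite Re_tr_sandwich -mulmxA.
Qed.

Lemma povm_factor n (X : finType) (M : X -> 'M[C]_n) : is_povm M ->
  exists2 T : X -> 'M[C]_n, (forall x, M x = (T x) ^t* *m T x) &
    \sum_x (T x) ^t* *m T x = 1%:M.
Proof.
move=> [pM sM]; have /choice[T TE] := fun x => psd_factor (pM x).
by exists T => //; rewrite -sM; apply: eq_bigr => x _; rewrite TE.
Qed.

Lemma step_prob_ge0 a m n r (A : 'I_r -> 'M[C]_(n, m)) Phi
    (rho : 'M[C]_(a * m)) (X : finType) (M : X -> 'M[C]_(a * n)) x :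
  is_kraus A Phi -> is_state rho -> is_povm M -> 0 <= step_prob Phi rho (M x).
Proof.
move=> KA /state_factor[S -> _] /povm_factor[T TE _].
rewrite TE (step_prob_kraus _ _ KA).
by apply: sumr_ge0 => k _; exact: fro2_ge0.
Qed.

Lemma sum_step_prob a m n r (A : 'I_r -> 'M[C]_(n, m)) Phi
    (rho : 'M[C]_(a * m)) (X : finType) (M : X -> 'M[C]_(a * n)) :
  is_kraus A Phi -> is_state rho -> is_povm M ->
  \sum_x step_prob Phi rho (M x) = 1.
Proof.
move=> KA /state_factor[S -> fS] /povm_factor[T TE TT].
under eq_bigr do rewrite TE (step_prob_kraus _ _ KA).
rewrite exchange_big /=; under eq_bigr do rewrite fro2_sum_isometry //.
rewrite fro2_sum_isometry ?fro2_adj //; apply: amp_kraus_isometry.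
by have [] := KA.
Qed.

Lemma answer_prob_ge0 m n r (A : 'I_r -> 'M[C]_(n, m)) Phi N
    (s : strategy R m n N) h : is_kraus A Phi -> 0 <= answer_prob s Phi h.
Proof.
move=> KA; elim: s => [[] |{}N a rho X M Hrho HM next IH] /=; first by case: h.
  by case: h.
apply: sumr_ge0 => x _; rewrite mulr_ge0 //.
exact: (step_prob_ge0 x KA Hrho HM).
Qed.

Lemma answer_prob_total m n r (A : 'I_r -> 'M[C]_(n, m)) Phi N
    (s : strategy R m n N) : is_kraus A Phi ->
  answer_prob s Phi H0 + answer_prob s Phi H1 = 1.
Proof.
move=> KA; elim: s => [[] |{}N a rho X M Hrho HM next IH] /=.
- by rewrite addr0.
- by rewrite add0r.
rewrite -big_split /= -(sum_step_prob KA Hrho HM); apply: eq_bigr => x _.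
by rewrite -mulrDr IH mulr1.
Qed.

Lemma is_kraus_id d : is_kraus (fun _ : 'I_1 => 1%:M : 'M[C]_d) idfun.
Proof.
split=> [|rho]; rewrite big_ord1 adj1; first exact: mul1mx.
by rewrite mul1mx mulmx1.
Qed.

Lemma step_prob_id a d (S T : 'M[C]_(a * d)) :
  step_prob (idfun : 'M[C]_d -> _) (S ^t* *m S) (T ^t* *m T) = fro2 (T *m S ^t*).
Proof. by rewrite (step_prob_kraus _ _ (is_kraus_id d)) big_ord1 amp1 mul1mx. Qed.

Definition phase d (u : C) (i : 'I_d) : 'M[C]_d :=
  diag_mx (\row_k if k == i then u else 1).

Definition half_phase d (u : C) (i : 'I_d) (rho : 'M[C]_d) : 'M[C]_d :=
  (2^-1)%:C *: (rho + phase u i *m rho *m (phase u i) ^t*).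

Definition half_phase_kraus d (u : C) (i : 'I_d) (k : 'I_2) : 'M[C]_d :=
  ((Num.sqrt 2)^-1)%:C *: (if k == ord0 then 1%:M else phase u i).

Lemma phase_unitary d u (i : 'I_d) : cabs2 u = 1 ->
  (phase u i) ^t* *m phase u i = 1%:M.
Proof.
move=> u1; rewrite tr_diag_mx map_diag_mx mulmx_diag -diag_const_mx.
congr diag_mx; apply/rowP => k; rewrite !mxE.
by case: ifP; rewrite mulJ_cabs2 ?u1 // -(rmorph1 (real_complex R)) cabs2_real expr1n.
Qed.

Lemma half_phase_is_kraus d u (i : 'I_d) : cabs2 u = 1 ->
  is_kraus (half_phase_kraus u i) (half_phase u i).
Proof.
pose h : C := ((Num.sqrt 2)^-1)%:C.
have hh : Num.conj h * h = (2^-1)%:C by rewrite mulJ_cabs2 cabs2_sqrt2V.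
move=> u1; split=> [|rho]; rewrite big_ord_recl big_ord1 /half_phase_kraus.
  have E (K : 'M[C]_d) : (h *: K) ^t* *m (h *: K) = (2^-1)%:C *: (K ^t* *m K).
    by rewrite adjZ -scalemxAr -scalemxAl scalerA mulrC hh.
  rewrite !E ?eqxx adj1 mulmx1 phase_unitary // -scalerDl -rmorphD.
  by rewrite (_ : 2^-1 + 2^-1 = 1) ?rmorph1 ?scale1r //; field.
have E (K : 'M[C]_d) : (h *: K) *m rho *m (h *: K) ^t* =
    (2^-1)%:C *: (K *m rho *m K ^t*).
  by rewrite adjZ -scalemxAr -!scalemxAl scalerA hh.
by rewrite !E ?eqxx mul1mx adj1 mulmx1 -scalerDr.
Qed.

Lemma step_prob_half_phase a d u (i : 'I_d) (S T : 'M[C]_(a * d)) : cabs2 u = 1 ->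
  step_prob (half_phase u i) (S ^t* *m S) (T ^t* *m T) =
    (fro2 (T *m S ^t*) + fro2 (T *m (amp a (phase u i) *m S ^t*))) / 2.
Proof.
move=> u1; rewrite (step_prob_kraus _ _ (half_phase_is_kraus i u1)).
have E (K : 'M[C]_d) : fro2 (T *m (amp a (((Num.sqrt 2)^-1)%:C *: K) *m S ^t*)) =
    2^-1 * fro2 (T *m (amp a K *m S ^t*)).
  by rewrite ampZ -scalemxAl -scalemxAr fro2Z cabs2_sqrt2V.
rewrite big_ord_recl big_ord1 (mulrC _ 2^-1) mulrDr.
congr (_ + _); last exact: (E (phase u i)).
by have := E 1%:M; rewrite [in RHS]amp1 mul1mx => <-.
Qed.

(** The difference of squares is [dot (A - B) (A + B)]; Cauchy-Schwarz and the parallelogram law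
    follow. It compares the two laws outcome by outcome. *)
Lemma fro2_sub_sqr_le m n (A B : 'M[C]_(m, n)) :
  (fro2 A - fro2 B) ^+ 2 <= 2 * fro2 (A - B) * (fro2 A + fro2 B).
Proof.
have -> : fro2 A - fro2 B = dot (A - B) (A + B).
  by rewrite dotDl !dotDr !(dotC (- B)) !dotNr /fro2; ring.
apply: (le_trans (dot_cauchy_schwarz _ _)).
by rewrite (mulrC 2) -mulrA ler_wpM2l ?fro2_ge0 ?fro2D_le.
Qed.

Lemma one_sub_phase d u (i : 'I_d) : 1%:M - phase u i = (1 - u) *: delta_mx i i.
Proof.
apply/matrixP => k l; rewrite !mxE; have [->|kl] := eqVneq k l.
  by case: eqVneq => _ /=; rewrite ?mulr1 ?mulr0 ?mulr1n ?subrr.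
rewrite (_ : (k == i) && (l == i) = false) ?subr0 ?mulr0 //.
by apply/negP => /andP[/eqP ki /eqP li]; rewrite ki li eqxx in kl.
Qed.

(** The matrix units on the diagonal resolve the identity, so all [d] positions together cost one
    [cabs2 (1 - u)]: this is the source of the factor [d] in the lower bound. *)
Lemma sum_fro2_one_sub_phase a d p u (Y : 'M[C]_(a * d, p)) :
  \sum_i fro2 (amp a (1%:M - phase u i) *m Y) = cabs2 (1 - u) * fro2 Y.
Proof.
under eq_bigr do rewrite one_sub_phase ampZ -scalemxAl fro2Z.
rewrite -mulr_sumr; congr (_ * _); apply: fro2_sum_isometry.
under eq_bigr do rewrite amp_adj amp_mul trmx_delta map_delta_mx mul_delta_mx.
by rewrite -amp_sum -mx1_sum_delta amp1.
Qed.

(* The channel being an equal mixture with the identity, the likelihood ratio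
   2p/(p+q) is bounded and its relative entropy is controlled by the squared
   Hellinger distance, although q may vanish where p does not. *)
Lemma likelihood_ge (p q : R) : 0 <= p -> 0 <= q ->
  p * expR (- ((p - q) / (p + q))) <= (p + q) / 2.
Proof.
move=> p0 q0; have [->|pn0] := eqVneq p 0.
  by rewrite mul0r add0r divr_ge0.
have pp : 0 < p by rewrite lt_def pn0.
have pq : 0 < p + q by rewrite ltr_pwDl.
rewrite expRN ler_pdivrMr ?expR_gt0 //.
have := expR_ge1Dx ((p - q) / (p + q)).
have -> : 1 + (p - q) / (p + q) = 2 * p / (p + q) by field; rewrite gt_eqF.
rewrite ler_pdivrMr // => H; lra.
Qed.

(** Each summand equals [(p - q) / 2] plus [(p - q)^2 / (2 (p + q))]: the first part sums to 0 and
    the second is at most [w]. Where [p + q] vanishes so does the summand. *)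
Lemma divergence_le (X : finType) (p q w : X -> R) :
  (forall x, 0 <= p x) -> (forall x, 0 <= q x) ->
  \sum_x p x = 1 -> \sum_x q x = 1 -> (forall x, 0 <= w x) ->
  (forall x, (p x - q x) ^+ 2 <= 2 * w x * (p x + q x)) ->
  \sum_x p x * ((p x - q x) / (p x + q x)) <= \sum_x w x.
Proof.
move=> p0 q0 p1 q1 w0 H.
have : \sum_x p x * ((p x - q x) / (p x + q x)) <=
    \sum_x ((p x - q x) / 2 + w x).
  apply: ler_sum => x _; have [E|n0] := eqVneq (p x + q x) 0.
    have px : p x = 0 by have := p0 x; have := q0 x; lra.
    have qx : q x = 0 by have := p0 x; have := q0 x; lra.
    by rewrite px qx mul0r subrr mul0r add0r.
  have pq : 0 < p x + q x by rewrite lt_def n0 addr_ge0.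
  rewrite mulrA ler_pdivrMr //; have := H x; lra.
move/le_trans; apply; rewrite big_split /= -mulr_suml sumrB p1 q1.
by rewrite subrr mul0r add0r.
Qed.

(** Average of the tangent line of [expR] at the mean [m]. *)
Lemma expR_jensen (X : finType) (p y : X -> R) :
  (forall x, 0 <= p x) -> \sum_x p x = 1 ->
  expR (\sum_x p x * y x) <= \sum_x p x * expR (y x).
Proof.
move=> p0 p1; set m := \sum_x p x * y x.
have -> : expR m = \sum_x p x * (expR m * (1 + (y x - m))).
  have -> : \sum_x p x * (expR m * (1 + (y x - m))) =
      expR m * (\sum_x p x * (1 - m) + m).
    rewrite /m -big_split /= mulr_sumr; apply: eq_bigr => x _; ring.
  by rewrite -mulr_suml p1 mul1r subrK mulr1.
apply: ler_sum => x _; rewrite ler_wpM2l //.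
have -> : expR (y x) = expR m * expR (y x - m) by rewrite -expRD addrC subrK.
by rewrite ler_wpM2l ?expR_ge0 ?expR_ge1Dx.
Qed.

(* [L i] bounds the relative entropy of the outcomes on the identity with respect
   to those on [half_phase u i], entering through Gibbs' variational principle.
   Outcomes on the identity do not depend on [i], so the sum over [i] can be
   taken at each step, where it costs a single [cabs2 (1 - u)]. *)
Lemma strategy_entropy d u lam N (s : strategy R d d N) : cabs2 u = 1 ->
  exists2 L : 'I_d -> R,
    forall i, expR (lam * answer_prob s idfun H0 - L i) <=
      expR lam * answer_prob s (half_phase u i) H0 + answer_prob s (half_phase u i) H1 &
    \sum_i L i <= N%:R * cabs2 (1 - u).
Proof.
move=> u1; elim: s => [h|{}N a rho X M Hrho HM next IH].
  exists (fun=> 0); last by rewrite big1 // mul0r.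
  by move=> i; case: h => /=; rewrite subr0 ?mulr1 ?mulr0 ?addr0 ?add0r ?expR0.
have /choice[L HL] : forall x, exists L : 'I_d -> R,
    (forall i, expR (lam * answer_prob (next x) idfun H0 - L i) <=
      expR lam * answer_prob (next x) (half_phase u i) H0 +
      answer_prob (next x) (half_phase u i) H1) /\
    \sum_i L i <= N%:R * cabs2 (1 - u).
  by move=> x; have [L L1 L2] := IH x; exists L.
have Kid := is_kraus_id d.
have Kh i := half_phase_is_kraus i u1.
pose p x := step_prob idfun rho (M x).
pose q' i x := step_prob (half_phase u i) rho (M x).
have p0 x : 0 <= p x by exact: step_prob_ge0 Kid Hrho HM.
have p1 : \sum_x p x = 1 by exact: sum_step_prob Kid Hrho HM.
have [S rhoE fS] := state_factor Hrho.
have [T TE TT] := povm_factor HM.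
pose q i x := fro2 (T x *m (amp a (phase u i) *m S ^t*)).
have pE x : p x = fro2 (T x *m S ^t*) by rewrite /p rhoE TE step_prob_id.
have q'E i x : q' i x = (p x + q i x) / 2.
  by rewrite pE /q' rhoE TE step_prob_half_phase.
have q0 i x : 0 <= q i x by exact: fro2_ge0.
have q1 i : \sum_x q i x = 1.
  rewrite /q fro2_sum_isometry // fro2_isometry ?fro2_adj //.
  by rewrite amp_adj amp_mul phase_unitary // amp1.
pose l i x := (p x - q i x) / (p x + q i x).
pose w i x := fro2 (T x *m (amp a (1%:M - phase u i) *m S ^t*)).
have Hl i : \sum_x p x * l i x <= \sum_x w i x.
  apply: (divergence_le p0 (q0 i) p1 (q1 i)) => x; first exact: fro2_ge0.
  rewrite pE /q /w; apply: le_trans (fro2_sub_sqr_le _ _) _.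
  by rewrite -mulmxBr ampB amp1 mulmxBl mul1mx.
(* Chain rule: the bounds of the subtrees are averaged under the law for the identity, and the
   current outcome adds its log-likelihood term. *)
exists (fun i => \sum_x p x * (L x i + l i x)) => [i|].
  have G : expR lam * answer_prob (Measurement Hrho HM next) (half_phase u i) H0 +
      answer_prob (Measurement Hrho HM next) (half_phase u i) H1 =
      \sum_x q' i x * (expR lam * answer_prob (next x) (half_phase u i) H0 +
         answer_prob (next x) (half_phase u i) H1).
    rewrite /= mulr_sumr -big_split /=; apply: eq_bigr => x _.
    by rewrite /q' /step_prob; ring.
  rewrite G.
  have -> : lam * answer_prob (Measurement Hrho HM next) idfun H0 -
      \sum_x p x * (L x i + l i x) =
    \sum_x p x * (lam * answer_prob (next x) idfun H0 - L x i - l i x).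
    rewrite /= mulr_sumr -sumrB; apply: eq_bigr => x _.
    by rewrite /p /step_prob; ring.
  (* Jensen brings the exponential inside; then [likelihood_ge] changes [p] into [q'] while the
     induction hypothesis handles the subtree. *)
  apply: (le_trans (expR_jensen _ p0 p1)); apply: ler_sum => x _.
  rewrite expRD mulrCA [leLHS]mulrC; apply: ler_pM.
  - by rewrite mulr_ge0 ?expR_ge0.
  - exact: expR_ge0.
  - by rewrite q'E; exact: likelihood_ge.
  - by have [] := HL x.
have -> : \sum_i \sum_x p x * (L x i + l i x) =
    \sum_i \sum_x p x * L x i + \sum_i \sum_x p x * l i x.
  rewrite -big_split; apply: eq_bigr => i _ /=.
  by rewrite -big_split; apply: eq_bigr => x _ /=; rewrite mulrDr.
rewrite -natr1 mulrDl mul1r; apply: lerD.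
  have -> : N%:R * cabs2 (1 - u) = \sum_x p x * (N%:R * cabs2 (1 - u)).
    by rewrite -mulr_suml p1 mul1r.
  rewrite exchange_big; apply: ler_sum => x _ /=.
  by rewrite -mulr_sumr; apply: ler_wpM2l => //; have [] := HL x.
apply: (@le_trans _ _ (\sum_i \sum_x w i x)); first exact: ler_sum.
under eq_bigr do rewrite /w fro2_sum_isometry //.
by rewrite sum_fro2_one_sub_phase fro2_adj fS mulr1.
Qed.

End LowerBound.

(** * Distance of the hard channels from the identity, and averaging over the seed *)

Section HardChannels.
Context {R : realType}.
Local Notation C := R[i].

Lemma has_ubound_trace_dist d r (A : 'I_r -> 'M[C]_d) Phi : is_kraus A Phi ->
  has_ubound [set schatten1 (Phi rho - idfun rho) | rho in @is_state R d].
Proof.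
move=> [AA PhiE]; exists 2 => _ [rho Hrho <-].
by rewrite PhiE; exact: schatten1_sub_id_le2.
Qed.

Lemma has_ubound_diamond_dist d r (A : 'I_r -> 'M[C]_d) Phi : is_kraus A Phi ->
  has_ubound [set schatten1 (id_tens (fun X => Phi X - idfun X) rho)
    | rho in @is_state R (d * d)].
Proof.
move=> KA; exists 2 => _ [rho Hrho <-]; rewrite (id_tens_sub_idfun _ KA).
by apply: schatten1_sub_id_le2 => //; apply: amp_kraus_isometry; case: KA.
Qed.

(** The coherence [1 / 2] of the pair state is sent to [(1 + u) / 4] up to conjugation-free phase, a
    change of [(u - 1) / 4]. *)
Lemma half_phase_sub_entry d u (i j : 'I_d) : i != j ->
  let psi : 'cV[C]_d := pair_vec false i j in
  cabs2 ((half_phase u i (proj psi) - proj psi) i j) = 16^-1 * cabs2 (1 - u).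
Proof.
move=> ij psi.
have psiE k : psi k 0 = ((Num.sqrt 2)^-1)%:C * ((k == i)%:R + (k == j)%:R).
  by rewrite !mxE expr0 mul1r !eqxx !andbT.
have pE : proj psi i j = (2^-1)%:C.
  rewrite mxE big_ord1 adjE !psiE !eqxx (negbTE ij) eq_sym (negbTE ij) addr0 add0r.
  by rewrite !mulr1 mulrC mulJ_cabs2 cabs2_sqrt2V.
have -> : (half_phase u i (proj psi) - proj psi) i j =
    (2^-1)%:C * ((2^-1)%:C * (u - 1)).
  rewrite /half_phase /phase tr_diag_mx map_diag_mx mul_mx_diag mul_diag_mx.
  move: pE; set P := proj psi; clearbody P => pE; rewrite !mxE pE eqxx.
  rewrite eq_sym (negbTE ij) rmorph1 mulr1.
  case: u => a b; apply/eqP; rewrite eq_complex /=.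
  by apply/andP; split; apply/eqP; field.
rewrite !cabs2M cabs2_real -(opprB 1 u).
by case: (1 - u) => a b; rewrite /cabs2 /=; field.
Qed.

Lemma half_phase_trace_dist d u (i j : 'I_d) : cabs2 u = 1 -> i != j ->
  Num.sqrt (16^-1 * cabs2 (1 - u)) <= trace_dist (R := R) (half_phase u i) idfun.
Proof.
move=> u1 ij; pose psi : 'cV[C]_d := pair_vec false i j.
rewrite -(half_phase_sub_entry u ij) -/psi.
apply: (le_trans (cabs2_le_schatten1 _ _ _)).
apply: ub_le_sup; first exact: has_ubound_trace_dist (half_phase_is_kraus i u1).
exists (proj psi) => //; apply: is_state_proj.
by rewrite adj_mul_col fro2_pair_vec.
Qed.

(** On the product input of [basis_vec i] with the pair state, the block [(i, i)] reproduces the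
    computation without ancilla. *)
Lemma half_phase_diamond_dist d u (i j : 'I_d) : cabs2 u = 1 -> i != j ->
  Num.sqrt (16^-1 * cabs2 (1 - u)) <= diamond_dist (R := R) (half_phase u i) idfun.
Proof.
move=> u1 ij; pose psi : 'cV[C]_d := pair_vec false i j.
pose V : 'M[C]_(d * d, 1 * 1) := mxtens.tensmx (basis_vec i) psi.
have VE : V *m V ^t* = mxtens.tensmx (proj (basis_vec i)) (proj psi).
  by rewrite /V mxtens.trmx_tens mxtens.map_mxT mxtens.tensmx_mul.
have VV : V ^t* *m V = 1%:M.
  rewrite /V mxtens.trmx_tens mxtens.map_mxT mxtens.tensmx_mul !adj_mul_col.
  rewrite fro2_basis_vec fro2_pair_vec // !rmorph1; exact: amp1.
pose idx := @mxtens.mxtens_index d d.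
have E : id_tens (fun X => half_phase u i X - idfun X) (V *m V ^t*)
    (idx (i, i)) (idx (i, j)) = (half_phase u i (proj psi) - proj psi) i j.
  rewrite mxE !mxtens.mxtens_indexK.
  rewrite (_ : \matrix_(k, l) _ = proj psi) //; apply/matrixP => k l.
  rewrite mxE VE mxtens.tensmxE [X in X * _](_ : _ = 1) ?mul1r //.
  by rewrite mxE big_ord1 adjE !mxE eqxx conjC1 mulr1.
rewrite -(half_phase_sub_entry u ij) -/psi -E.
apply: (le_trans (cabs2_le_schatten1 _ _ _)).
apply: ub_le_sup; first exact: has_ubound_diamond_dist (half_phase_is_kraus i u1).
by exists (V *m V ^t*) => //; exact: is_state_proj.
Qed.

Lemma exists_phase (s : R) : 0 <= s -> s <= 4 ->
  exists2 u : C, cabs2 u = 1 & cabs2 (1 - u) = s.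
Proof.
move=> s0 s4; exists (Complex (1 - s / 2) (Num.sqrt (s - s ^+ 2 / 4))).
  rewrite /cabs2 /= sqr_sqrtr; first by field.
  have := mulr_ge0 s0 (_ : 0 <= 4 - s); rewrite subr_ge0 => /(_ s4); lra.
rewrite /cabs2 /= add0r sqrrN sqr_sqrtr; first by field.
have := mulr_ge0 s0 (_ : 0 <= 4 - s); rewrite subr_ge0 => /(_ s4); lra.
Qed.

(** [expR_ge1Dx] linearises the entropy inequality at [lam = 1 / 4]. Being linear in the answer
    probabilities, the result can be integrated over the seed. *)
Lemma strategy_lower_bound d u N (s : strategy R d d N) : cabs2 u = 1 ->
  d%:R * (1 / 4) * answer_prob s idfun H0 +
    \sum_(i < d) (expR (1 / 4) - 1) * answer_prob s (half_phase u i) H1 <=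
  d%:R * (expR (1 / 4) - 1) + N%:R * cabs2 (1 - u).
Proof.
move=> u1; have [L HL SL] := strategy_entropy (1 / 4) s u1.
have H i : 1 / 4 * answer_prob s idfun H0 +
    (expR (1 / 4) - 1) * answer_prob s (half_phase u i) H1 <= (expR (1 / 4) - 1) + L i.
  have := le_trans (expR_ge1Dx _) (HL i).
  have := answer_prob_total s (half_phase_is_kraus i u1).
  set b0 := answer_prob _ _ H0; set b1 := answer_prob _ _ H1 => E.
  have {E} -> : b0 = 1 - b1 by rewrite -E addrK.
  lra.
have := ler_sum (index_enum _) (fun i (_ : xpredT i) => H i).
rewrite !big_split /= !sumr_const card_ord => S.
rewrite -mulrA (mulr_natl _ d) (mulr_natl (expR _ - 1) d).
by apply: (le_trans S); rewrite -mulrnDl lerD2l.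
Qed.

Lemma algorithm_lower_bound d u N (A : algorithm R d d N) : cabs2 u = 1 ->
  ((2 / 3)%:E <= output_prob A idfun H0)%E ->
  (forall i, (2 / 3)%:E <= output_prob A (half_phase u i) H1)%E ->
  d%:R / 18 <= N%:R * cabs2 (1 - u).
Proof.
move=> u1 HA0 HA1.
pose K : R := expR (1 / 4) - 1.
have K0 : 0 <= K by have := expR_ge1Dx (1 / 4 : R); rewrite /K; lra.
(* [expR (- (1 / 4))] is at least [3 / 4]. Then [1 / 6 - K / 3] is at least the constant [1 / 18] of
   the conclusion. *)
have K3 : K <= 1 / 3.
  have := expR_ge1Dx (- (1 / 4) : R); rewrite expRN => H.
  have e0 := expR_gt0 (1 / 4 : R).
  have : expR (1 / 4) * (1 - 1 / 4) <= expR (1 / 4) * (expR (1 / 4))^-1 :> R.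
    by rewrite ler_pM2l.
  rewrite divff ?gt_eqF // /K; lra.
have Kid := is_kraus_id d (R := R).
have Cid : is_channel (idfun : 'M[C]_d -> _) by exists 1%N, (fun=> 1%:M); exact: Kid.
have Kh (i : 'I_d) := half_phase_is_kraus i u1.
have Ch (i : 'I_d) : is_channel (half_phase u i)
  by exists 2%N, (half_phase_kraus u i); exact: Kh.
pose P := seed_law A.
pose a w := answer_prob (run A w) idfun H0.
pose g (i : 'I_d) w := answer_prob (run A w) (half_phase u i) H1.
have /measurable_EFinP ma : measurable_fun setT a by exact: run_measurable.
have mg i : measurable_fun setT (fun w => (g i w)%:E).
  by have /measurable_EFinP : measurable_fun setT (g i) by exact: run_measurable.
have a0 w : 0 <= a w by exact: (answer_prob_ge0 _ _ Kid).
have g0 i w : 0 <= g i w by exact: (answer_prob_ge0 _ _ (Kh i)).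
have d4 : 0 <= d%:R * (1 / 4) :> R by rewrite mulr_ge0 ?ler0n.
pose c : R := d%:R * K + N%:R * cabs2 (1 - u).
have : (\int[P]_w ((d%:R * (1 / 4))%:E * (a w)%:E + \sum_(i < d) K%:E * (g i w)%:E)
    <= c%:E)%E.
  have -> : c%:E = (\int[P]_w (cst c%:E w))%E.
    rewrite integral_cst // -[LHS]mule1; congr (_ * _)%E.
    by symmetry; exact: probability_setT.
  apply: ge0_le_integral => //.
  - move=> w _; rewrite adde_ge0 ?mule_ge0 ?lee_fin //.
    by apply: sume_ge0 => i _; rewrite mule_ge0 ?lee_fin.
  - apply: emeasurable_funD; first exact: measurable_funeM.
    by apply: emeasurable_sum => i; exact: measurable_funeM.
  - move=> w _; rewrite -EFinM; under eq_bigr do rewrite -EFinM.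
    rewrite sumEFin -EFinD lee_fin; exact: strategy_lower_bound.
rewrite ge0_integralD //; first last.
- by apply: emeasurable_sum => i; exact: measurable_funeM.
- by move=> w _; apply: sume_ge0 => i _; rewrite mule_ge0 ?lee_fin.
- exact: measurable_funeM.
- by move=> w _; rewrite mule_ge0 ?lee_fin.
rewrite ge0_integralZl //; last by move=> w _; rewrite lee_fin.
rewrite ge0_integral_sum //; first last.
- by move=> i w _; rewrite mule_ge0 ?lee_fin.
- by move=> i; exact: measurable_funeM.
have Zg i : (\int[P]_w (K%:E * (g i w)%:E) = K%:E * \int[P]_w (g i w)%:E)%E.
  by apply: ge0_integralZl => // [w _]; rewrite lee_fin.
under eq_bigr do rewrite Zg.
move=> H.
have {H} : ((d%:R * (1 / 4))%:E * (2 / 3)%:E + \sum_(i < d) K%:E * (2 / 3)%:E <= c%:E)%E.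
  apply: le_trans H; apply: leeD; first by apply: lee_wpmul2l; rewrite ?lee_fin.
  by apply: lee_sum => i _; apply: lee_wpmul2l; rewrite ?lee_fin //; exact: HA1.
rewrite -!EFinM sumEFin -EFinD lee_fin sumr_const card_ord -mulr_natl /c.
have : d%:R * K <= d%:R * (1 / 3) by rewrite ler_wpM2l ?ler0n.
lra.
Qed.

(** The error is one-sided: the identity passes every probe with certainty. *)
Lemma identity_test_complete d N (x : probe_index d) :
  answer_prob (identity_test (R := R) N H0 x) idfun H1 = 0.
Proof.
have Kid := is_kraus_id (R := R) d.
have F1 (y : probe_index d) : fidelity (fun _ : 'I_1 => 1%:M : 'M[C]_d) (probe y) = 1.
  rewrite /fidelity big_ord1 mulmx1 adj_mul_col fro2_probe mxE.
  by rewrite cabs2_real expr1n.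
have := answer_prob_total (identity_test N H0 x) Kid.
case: N => [//|N]; rewrite (answer_prob_identity_test _ _ Kid) F1 mul1r.
have -> : mean_fidelity (fun _ : 'I_1 => 1%:M : 'M[C]_d) = 1.
  rewrite /mean_fidelity; under eq_bigr do rewrite F1.
  rewrite sumr_const -[1 *+ _]/(_%:R) mulVf // pnatr_eq0 -lt0n.
  by apply/card_gt0P; exists x.
by rewrite expr1n => /(canRL (addKr _)); rewrite addNr.
Qed.

End HardChannels.

Theorem theorem3p1 (R : realType) :
  (exists (C : R)
      (A : forall d N : nat, (1 <= d)%N -> (1 <= N)%N -> algorithm R d d N),
    [/\ 0 < C,
        forall d N (d_ge1 : (1 <= d)%N) (N_ge1 : (1 <= N)%N),
          ancilla_free_algorithm (A d N d_ge1 N_ge1) &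
        forall d N (d_ge1 : (1 <= d)%N) (N_ge1 : (1 <= N)%N) (eps : R),
          0 < eps ->
          (N%:Z = Num.ceil (C * d%:R / eps ^+ 2) ->
             one_third_correct (A d N d_ge1 N_ge1)
               (fun Phi => Phi = idfun)
               (fun Phi => eps <= trace_dist Phi idfun)) /\
          (N%:Z = Num.ceil (C * d%:R / eps ^+ 4) ->
             one_third_correct (A d N d_ge1 N_ge1)
               (fun Phi => Phi = idfun)
               (fun Phi => eps <= diamond_dist Phi idfun))]) /\
  (exists (c eps0 : R) (d0 : nat),
    [/\ 0 < c, 0 < eps0, (1 <= d0)%N &
        forall (d : nat) (eps : R),
          (d0 <= d)%N -> 0 < eps -> eps <= eps0 ->
          forall (N : nat) (A : algorithm R d d N),
            (distinguishes A (fun Phi => Phi = idfun)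
               (fun Phi => eps < diamond_dist Phi idfun) ->
             c * d%:R / eps ^+ 2 <= N%:R) /\
            (distinguishes A (fun Phi => Phi = idfun)
               (fun Phi => eps < trace_dist Phi idfun) ->
             c * d%:R / eps ^+ 2 <= N%:R)]).
Proof.
split.
  (* The initial probe is a basis vector, [d_ge1] providing its index. *)
  exists 576, (fun d N (d_ge1 : (1 <= d)%N) _ => trivial_algorithm
    (identity_test N H0 (true, true, (Ordinal d_ge1, Ordinal d_ge1)))).
  split=> [|d N d_ge1 N_ge1 w|d N d_ge1 N_ge1 eps eps0].
  - by rewrite ltr0n.
  - exact: identity_test_ancilla_free.
  set x : probe_index d := (true, true, _).
  have null Phi : is_channel Phi -> Phi = idfun ->
      (output_prob (trivial_algorithm (R := R) (identity_test N H0 x)) Phi H1 <= (1 / 3)%:E)%E.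
    move=> _ ->; rewrite output_prob_trivial lee_fin.
    by rewrite identity_test_complete divr_ge0.
  have alt (Phi : 'M[R[i]]_d -> 'M[R[i]]_d) : is_channel Phi ->
      eps <= trace_dist Phi idfun \/ eps <= diamond_dist Phi idfun ->
      576 * d%:R / eps ^+ 2 <= N%:R \/ 576 * d%:R / eps ^+ 4 <= N%:R ->
      (output_prob (trivial_algorithm (R := R) (identity_test N H0 x)) Phi H0 <= (1 / 3)%:E)%E.
    move=> [r [A KA]] Heps HN; rewrite output_prob_trivial lee_fin.
    exact: identity_test_sound d_ge1 KA eps0 Heps HN.
  have ceil_le (z : R) : N%:Z = Num.ceil z -> z <= N%:R.
    by move=> E; rewrite -[N%:R]/(N%:Z%:~R) E ceil_ge.
  by split=> /ceil_le HN Phi HPhi; split=> HP; [exact: null| |exact: null|];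
    apply: alt => //; [left|left|right|right].
(* 450 is [18 * 25], from [cabs2 (1 - u) = 25 * eps ^+ 2]; [eps <= 1 / 5] keeps this below 4, the
   limit for a phase; [2 <= d] gives each position a partner. *)
exists (1 / 450), (1 / 5), 2%N.
split=> [|||d eps d2 eps0 epsle N A];
  [by rewrite divr_gt0 ?ltr01 ?ltr0n|by rewrite divr_gt0 ?ltr01 ?ltr0n|by []|].
have [u u1 ku] : exists2 u : R[i], cabs2 u = 1 & cabs2 (1 - u) = 25 * eps ^+ 2.
  by apply: exists_phase; [rewrite mulr_ge0 ?sqr_ge0 | rewrite expr2; nra].
(* The distance obtained is [5 / 4 * eps], so the strict inequality of the alternative holds. *)
have far : eps < Num.sqrt (16^-1 * cabs2 (1 - u)).
  have -> : 16^-1 * cabs2 (1 - u) = (5 / 4 * eps) ^+ 2 by rewrite ku; field.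
  by rewrite sqrtr_sqr ger0_norm; lra.
have other (i : 'I_d) : exists j : 'I_d, i != j.
  have [i0|i0] := eqVneq (i : nat) 0%N.
    by exists (Ordinal d2); rewrite -val_eqE /= i0.
  by exists (Ordinal (ltnW d2)); rewrite -val_eqE.
have null_channel : is_channel (idfun : 'M[R[i]]_d -> 'M[R[i]]_d).
  by exists 1%N, (fun=> 1%:M); exact: is_kraus_id.
have hard_channel (i : 'I_d) : is_channel (half_phase u i).
  by exists 2%N, (half_phase_kraus u i); exact: half_phase_is_kraus.
have goal : ((2 / 3)%:E <= output_prob A idfun H0)%E ->
    (forall i, (2 / 3)%:E <= output_prob A (half_phase u i) H1)%E ->
    1 / 450 * d%:R / eps ^+ 2 <= N%:R.
  move=> h0 h1; have := algorithm_lower_bound u1 h0 h1; rewrite ku => H.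
  rewrite ler_pdivrMr ?exprn_gt0 //; lra.
split=> HA; apply: goal => [|i].
- by have [/(_ erefl)] := HA _ null_channel.
- have [_] := HA _ (hard_channel i); apply; have [j ij] := other i.
  exact: lt_le_trans far (half_phase_diamond_dist u1 ij).
- by have [/(_ erefl)] := HA _ null_channel.
- have [_] := HA _ (hard_channel i); apply; have [j ij] := other i.
  exact: lt_le_trans far (half_phase_trace_dist u1 ij).
Qed.
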